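(* The assignments $(-)^{\bowtie}\colon \mathsf{bRSA}\to\mathsf{SM}$ and $(-)_{\bowtie}\colon\mathsf{SM}\to\mathsf{bRSA}$ described below are functors which witness a (covariant) equivalence of the categories $\mathsf{bRSA}$ and $\mathsf{SM}$.
   Context: A Brouwerian algebra is $(A,\wedge,\vee,\to,t)$ with $(A,\wedge,\vee)$ a lattice with top $t$ and $a\wedge b\le c\iff a\le b\to c$. A relative Stone algebra is a Brouwerian algebra satisfying $(a\to b)\vee(b\to a)=t$. A bRS-algebra is $(A,\wedge,\vee,\to,t,f)$ where $(A,\wedge,\vee,\to,t)$ is a relative Stone algebra and $f\in A$ satisfies $a\vee(a\to f)=t$ for all $a$; $\mathsf{bRSA}$ is the category of bRS-algebras and homomorphisms. A Sugihara monoid is $(A,\wedge,\vee,\cdot,\to,t,\neg)$ with $(A,\wedge,\vee)$ a distributive lattice, $(A,\cdot,t)$ a commutative monoid, $a\cdot b\le c\iff a\le b\to c$, $x\cdot x=x$, $\neg\neg x=x$, $x\to\neg y=y\to\neg x$; $\mathsf{SM}$ is the category of Sugihara monoids and homomorphisms. Functor $(-)_{\bowtie}$: for a Sugihara monoid $\mathbf A$, $\mathbf A_{\bowtie}=(A^-,\wedge,\vee,\to^-,t,\neg t)$ where $A^-=\{a: a\le t\}$ and $a\to^- b=(a\to b)\wedge t$; on morphisms $h_{\bowtie}=h\restriction_{A^-}$. Functor $(-)^{\bowtie}$: for a bRS-algebra $\mathbf A$ put $Na=f\to a$, $\Sigma(\mathbf A)=\{\langle a,b\rangle\in A^2: a\vee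 b=t,\ Nb=b\}$, $A^{\bowtie}=\{\langle a,b\rangle\in A^2: a\vee b=t,\ a\wedge b\le f\}$, with $\langle a,b\rangle\wedge\langle c,d\rangle=\langle a\wedge c,b\vee d\rangle$, $\langle a,b\rangle\vee\langle c,d\rangle=\langle a\vee c,b\wedge d\rangle$. On pairs define $\langle a,b\rangle*\langle c,d\rangle=\langle ((a\to d)\wedge(c\to b))\to(a\wedge c),\ N((a\to d)\wedge(c\to b))\rangle$ and $\langle a,b\rangle\Rightarrow\langle c,d\rangle=\langle (a\to c)\wedge(d\to b),\ N(((a\to c)\wedge(d\to b))\to(a\wedge d))\rangle$. Let $\delta\langle a,b\rangle=\langle a,f\to b\rangle$ and $\varepsilon\langle a,b\rangle=\langle a,b\wedge(a\to f)\rangle$. Then $\mathbf A^{\bowtie}=(A^{\bowtie},\wedge,\vee,\odot,\Rightarrow',\langle t,f\rangle,\sim)$ where $p\odot q=\varepsilon(\delta p*\delta q)$, $p\Rightarrow' q=\varepsilon(\delta p\Rightarrow\delta q)$, and $\sim\langle a,b\rangle=\langle b,a\rangle$. On morphisms $h^{\bowtie}\langle a,b\rangle=\langle h(a),h(b)\rangle$. *)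

(* Defs.v *)
From Stdlib Require Import ProofIrrelevance.

Set Implicit Arguments.
Unset Strict Implicit.

(** * Categories *)

Record category : Type := Category {
  ob :> Type;
  hom : ob -> ob -> Type;
  idm : forall X : ob, hom X X;
  comp : forall X Y Z : ob, hom Y Z -> hom X Y -> hom X Z;
  comp_id_l : forall (X Y : ob) (u : hom X Y), comp (idm Y) u = u;
  comp_id_r : forall (X Y : ob) (u : hom X Y), comp u (idm X) = u;
  comp_assoc : forall (X Y Z W : ob) (w : hom Z W) (v : hom Y Z) (u : hom X Y),
    comp w (comp v u) = comp (comp w v) u
}.
Arguments hom {c} X Y.
Arguments idm {c} X.
Arguments comp {c X Y Z} v u.

(* An assignment on objects and morphisms; [is_functor] is the functor laws. *)
Record assignment (C D : category) : Type := Assignment {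
  on_ob :> C -> D;
  on_hom : forall X Y : C, hom X Y -> hom (on_ob X) (on_ob Y)
}.
Arguments on_hom {C D} a {X Y} u.

Record is_functor (C D : category) (F : assignment C D) : Prop := {
  functor_id : forall X : C, on_hom F (idm X) = idm (F X);
  functor_comp : forall (X Y Z : C) (v : hom Y Z) (u : hom X Y),
    on_hom F (comp v u) = comp (on_hom F v) (on_hom F u)
}.

Definition id_assignment (C : category) : assignment C C :=
  {| on_ob := fun X => X; on_hom := fun X Y u => u |}.

Definition comp_assignment (C D E : category)
    (G : assignment D E) (F : assignment C D) : assignment C E :=
  {| on_ob := fun X => G (F X); on_hom := fun X Y u => on_hom G (on_hom F u) |}.

Definition is_iso (C : category) (X Y : C) (u : hom X Y) : Prop :=
  exists v : hom Y X, comp v u = idm X /\ comp u v = idm Y.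

Definition naturally_isomorphic (C D : category) (F G : assignment C D) : Prop :=
  exists eta : forall X : C, hom (F X) (G X),
    (forall (X Y : C) (u : hom X Y),
       comp (on_hom G u) (eta X) = comp (eta Y) (on_hom F u)) /\
    (forall X : C, is_iso (eta X)).

Definition witness_equivalence (C D : category)
    (F : assignment C D) (G : assignment D C) : Prop :=
  is_functor F /\ is_functor G /\
  naturally_isomorphic (id_assignment C) (comp_assignment G F) /\
  naturally_isomorphic (comp_assignment F G) (id_assignment D).

(** * Lattices *)

Record is_lattice (T : Type) (meet join : T -> T -> T) : Prop := {
  meetC : forall a b, meet a b = meet b a;
  joinC : forall a b, join a b = join b a;
  meetA : forall a b c, meet a (meet b c) = meet (meet a b) c;
  joinA : forall a b c, join a (join b c) = join (join a b) c;
  meet_joinK : forall a b, meet a (join a b) = a;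
  join_meetK : forall a b, join a (meet a b) = a
}.

(** * bRS-algebras *)

Record bRS_sig : Type := BRSSig {
  bcar :> Type;
  bmeet : bcar -> bcar -> bcar;
  bjoin : bcar -> bcar -> bcar;
  bimp : bcar -> bcar -> bcar;
  bt : bcar;
  bf : bcar
}.
Arguments bmeet {b} _ _.
Arguments bjoin {b} _ _.
Arguments bimp {b} _ _.
Arguments bt {b}.
Arguments bf {b}.

Definition ble (A : bRS_sig) (a b : A) : Prop := bmeet a b = a.

Declare Scope bRS_scope.
Delimit Scope bRS_scope with bRS.
Notation "a ⊓ b" := (bmeet a b) (at level 40, left associativity) : bRS_scope.
Notation "a ⊔ b" := (bjoin a b) (at level 50, left associativity) : bRS_scope.
Notation "a ⇀ b" := (bimp a b) (at level 55, right associativity) : bRS_scope.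
Notation "a ⊑ b" := (ble a b) (at level 70, no associativity) : bRS_scope.

Record is_Brouwerian (A : bRS_sig) : Prop := {
  Brouwerian_lattice : is_lattice (@bmeet A) (@bjoin A);
  Brouwerian_top : forall a : A, (a ⊑ bt)%bRS;
  Brouwerian_residuation : forall a b c : A, (a ⊓ b ⊑ c <-> a ⊑ (b ⇀ c))%bRS
}.

Record is_relative_Stone (A : bRS_sig) : Prop := {
  relative_Stone_Brouwerian : is_Brouwerian A;
  relative_Stone_prelinear : forall a b : A, ((a ⇀ b) ⊔ (b ⇀ a) = bt)%bRS
}.

Record is_bRS (A : bRS_sig) : Prop := {
  bRS_relative_Stone : is_relative_Stone A;
  bRS_f : forall a : A, (a ⊔ (a ⇀ bf) = bt)%bRS
}.

Record bRS_algebra : Type := BRSAlgebra {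
  bRS_ops :> bRS_sig;
  bRS_axioms : is_bRS bRS_ops
}.

Record is_bRS_hom (A B : bRS_sig) (h : A -> B) : Prop := {
  bRS_hom_meet : forall a b : A, h (bmeet a b) = bmeet (h a) (h b);
  bRS_hom_join : forall a b : A, h (bjoin a b) = bjoin (h a) (h b);
  bRS_hom_imp : forall a b : A, h (bimp a b) = bimp (h a) (h b);
  bRS_hom_t : h bt = bt;
  bRS_hom_f : h bf = bf
}.

Record bRS_hom (A B : bRS_algebra) : Type := BRSHom {
  bRS_fun :> A -> B;
  bRS_funP : is_bRS_hom bRS_fun
}.

Lemma bRS_hom_eq (A B : bRS_algebra) (g h : bRS_hom A B) :
  bRS_fun g = bRS_fun h -> g = h.
Proof.
  destruct g as [g Hg], h as [h Hh]; simpl; intros e; subst h.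
  f_equal; apply proof_irrelevance.
Qed.

Lemma bRS_id_hom (A : bRS_algebra) : @is_bRS_hom A A (fun a => a).
Proof. split; reflexivity. Qed.

Lemma bRS_comp_hom (A B C : bRS_algebra) (h : bRS_hom B C) (g : bRS_hom A B) :
  @is_bRS_hom A C (fun a => h (g a)).
Proof.
  destruct g as [g Hg], h as [h Hh]; simpl; destruct Hg, Hh.
  split; intros; congruence.
Qed.

Definition bRSA : category.
Proof.
  refine {| ob := bRS_algebra;
            hom := bRS_hom;
            idm := fun A => BRSHom (bRS_id_hom A);
            comp := fun A B C h g => BRSHom (bRS_comp_hom h g) |};
    intros; apply bRS_hom_eq; reflexivity.
Defined.

(** * Sugihara monoids *)

Record SM_sig : Type := SMSig {
  scar :> Type;
  smeet : scar -> scar -> scar;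
  sjoin : scar -> scar -> scar;
  smul : scar -> scar -> scar;
  simp : scar -> scar -> scar;
  st : scar;
  sneg : scar -> scar
}.
Arguments smeet {s} _ _.
Arguments sjoin {s} _ _.
Arguments smul {s} _ _.
Arguments simp {s} _ _.
Arguments st {s}.
Arguments sneg {s} _.

Definition sle (S : SM_sig) (x y : S) : Prop := smeet x y = x.

Record is_SM (S : SM_sig) : Prop := {
  SM_lattice : is_lattice (@smeet S) (@sjoin S);
  SM_distributive : forall x y z : S,
    smeet x (sjoin y z) = sjoin (smeet x y) (smeet x z);
  SM_mulA : forall x y z : S, smul x (smul y z) = smul (smul x y) z;
  SM_mulC : forall x y : S, smul x y = smul y x;
  SM_mul1 : forall x : S, smul x st = x;
  SM_residuation : forall x y z : S, sle (smul x y) z <-> sle x (simp y z);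
  SM_mul_idem : forall x : S, smul x x = x;
  SM_negK : forall x : S, sneg (sneg x) = x;
  SM_contraposition : forall x y : S, simp x (sneg y) = simp y (sneg x)
}.

Record SM_algebra : Type := SMAlgebra {
  SM_ops :> SM_sig;
  SM_axioms : is_SM SM_ops
}.

Record is_SM_hom (S T : SM_sig) (h : S -> T) : Prop := {
  SM_hom_meet : forall x y : S, h (smeet x y) = smeet (h x) (h y);
  SM_hom_join : forall x y : S, h (sjoin x y) = sjoin (h x) (h y);
  SM_hom_mul : forall x y : S, h (smul x y) = smul (h x) (h y);
  SM_hom_imp : forall x y : S, h (simp x y) = simp (h x) (h y);
  SM_hom_t : h st = st;
  SM_hom_neg : forall x : S, h (sneg x) = sneg (h x)
}.

Record SM_hom (S T : SM_algebra) : Type := SMHom {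
  SM_fun :> S -> T;
  SM_funP : is_SM_hom SM_fun
}.

Lemma SM_hom_eq (S T : SM_algebra) (g h : SM_hom S T) :
  SM_fun g = SM_fun h -> g = h.
Proof.
  destruct g as [g Hg], h as [h Hh]; simpl; intros e; subst h.
  f_equal; apply proof_irrelevance.
Qed.

Lemma SM_id_hom (S : SM_algebra) : @is_SM_hom S S (fun x => x).
Proof. split; reflexivity. Qed.

Lemma SM_comp_hom (S T U : SM_algebra) (h : SM_hom T U) (g : SM_hom S T) :
  @is_SM_hom S U (fun x => h (g x)).
Proof.
  destruct g as [g Hg], h as [h Hh]; simpl; destruct Hg, Hh.
  split; intros; congruence.
Qed.

Definition SM : category.
Proof.
  refine {| ob := SM_algebra;
            hom := SM_hom;
            idm := fun S => SMHom (SM_id_hom S);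
            comp := fun S T U h g => SMHom (SM_comp_hom h g) |};
    intros; apply SM_hom_eq; reflexivity.
Defined.

(** * The assignment [(-)_bowtie : SM -> bRSA] *)

Definition in_neg_cone (S : SM_sig) (x : S) : Prop := sle x st.

Definition neg_imp (S : SM_sig) (x y : S) : S := smeet (simp x y) st.

Record lower_closed (S : SM_sig) : Prop := {
  lower_meet : forall x y : S,
    in_neg_cone x -> in_neg_cone y -> in_neg_cone (smeet x y);
  lower_join : forall x y : S,
    in_neg_cone x -> in_neg_cone y -> in_neg_cone (sjoin x y);
  lower_imp : forall x y : S,
    in_neg_cone x -> in_neg_cone y -> in_neg_cone (neg_imp x y);
  lower_t : in_neg_cone (@st S);
  lower_f : in_neg_cone (sneg (@st S))
}.

Definition lower_sig (S : SM_sig) (c : lower_closed S) : bRS_sig := {|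
  bcar := {x : S | in_neg_cone x};
  bmeet := fun x y => exist _ (smeet (proj1_sig x) (proj1_sig y))
                        (lower_meet c (proj2_sig x) (proj2_sig y));
  bjoin := fun x y => exist _ (sjoin (proj1_sig x) (proj1_sig y))
                        (lower_join c (proj2_sig x) (proj2_sig y));
  bimp := fun x y => exist _ (neg_imp (proj1_sig x) (proj1_sig y))
                       (lower_imp c (proj2_sig x) (proj2_sig y));
  bt := exist _ st (lower_t c);
  bf := exist _ (sneg st) (lower_f c)
|}.

Definition restrict (S T : Type) (P : S -> Prop) (Q : T -> Prop) (h : S -> T)
    (PQ : forall x, P x -> Q (h x)) (x : {x : S | P x}) : {y : T | Q y} :=
  exist _ (h (proj1_sig x)) (PQ (proj1_sig x) (proj2_sig x)).

(* The facts needed for the construction to land in [bRSA], on objects and on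
   morphisms. *)
Record lower_well_defined : Prop := {
  lower_ob_closed : forall S : SM_algebra, lower_closed S;
  lower_ob_bRS : forall S : SM_algebra, is_bRS (lower_sig (lower_ob_closed S));
  lower_hom_closed : forall (S T : SM_algebra) (h : SM_hom S T) (x : S),
    in_neg_cone x -> in_neg_cone (h x);
  lower_hom_bRS : forall (S T : SM_algebra) (h : SM_hom S T),
    @is_bRS_hom (lower_sig (lower_ob_closed S)) (lower_sig (lower_ob_closed T))
      (restrict (lower_hom_closed h))
}.

Definition lower_ob (w : lower_well_defined) (S : SM_algebra) : bRS_algebra :=
  BRSAlgebra (lower_ob_bRS w S).

Definition lower_hom (w : lower_well_defined) (S T : SM_algebra)
    (h : SM_hom S T) : bRS_hom (lower_ob w S) (lower_ob w T) :=
  @BRSHom (lower_ob w S) (lower_ob w T) _ (lower_hom_bRS w h).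

Definition bowtie_lower (w : lower_well_defined) : assignment SM bRSA :=
  @Assignment SM bRSA (lower_ob w) (lower_hom w).

(** * The assignment [(-)^bowtie : bRSA -> SM] *)

Definition bN (A : bRS_sig) (a : A) : A := (bf ⇀ a)%bRS.

Definition in_bowtie (A : bRS_sig) (p : A * A) : Prop :=
  let (a, b) := p in (a ⊔ b = bt /\ a ⊓ b ⊑ bf)%bRS.

Definition pair_meet (A : bRS_sig) (p q : A * A) : A * A :=
  let (a, b) := p in let (c, d) := q in (a ⊓ c, b ⊔ d)%bRS.

Definition pair_join (A : bRS_sig) (p q : A * A) : A * A :=
  let (a, b) := p in let (c, d) := q in (a ⊔ c, b ⊓ d)%bRS.

Definition pair_star (A : bRS_sig) (p q : A * A) : A * A :=
  let (a, b) := p in let (c, d) := q in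
  (((a ⇀ d) ⊓ (c ⇀ b)) ⇀ (a ⊓ c), bN ((a ⇀ d) ⊓ (c ⇀ b)))%bRS.

Definition pair_arrow (A : bRS_sig) (p q : A * A) : A * A :=
  let (a, b) := p in let (c, d) := q in
  ((a ⇀ c) ⊓ (d ⇀ b), bN (((a ⇀ c) ⊓ (d ⇀ b)) ⇀ (a ⊓ d)))%bRS.

Definition delta (A : bRS_sig) (p : A * A) : A * A :=
  let (a, b) := p in (a, bf ⇀ b)%bRS.

Definition epsilon (A : bRS_sig) (p : A * A) : A * A :=
  let (a, b) := p in (a, b ⊓ (a ⇀ bf))%bRS.

Definition pair_mul (A : bRS_sig) (p q : A * A) : A * A :=
  epsilon (pair_star (delta p) (delta q)).

Definition pair_imp (A : bRS_sig) (p q : A * A) : A * A :=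
  epsilon (pair_arrow (delta p) (delta q)).

Definition pair_neg (A : bRS_sig) (p : A * A) : A * A :=
  let (a, b) := p in (b, a).

Definition pair_map (A B : bRS_sig) (h : A -> B) (p : A * A) : B * B :=
  let (a, b) := p in (h a, h b).

Record upper_closed (A : bRS_sig) : Prop := {
  upper_meet : forall p q : A * A,
    in_bowtie p -> in_bowtie q -> in_bowtie (pair_meet p q);
  upper_join : forall p q : A * A,
    in_bowtie p -> in_bowtie q -> in_bowtie (pair_join p q);
  upper_mul : forall p q : A * A,
    in_bowtie p -> in_bowtie q -> in_bowtie (pair_mul p q);
  upper_imp : forall p q : A * A,
    in_bowtie p -> in_bowtie q -> in_bowtie (pair_imp p q);
  upper_t : in_bowtie (@bt A, @bf A);
  upper_neg : forall p : A * A, in_bowtie p -> in_bowtie (pair_neg p)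
}.

Definition upper_sig (A : bRS_sig) (c : upper_closed A) : SM_sig := {|
  scar := {p : A * A | in_bowtie p};
  smeet := fun p q => exist _ (pair_meet (proj1_sig p) (proj1_sig q))
                        (upper_meet c (proj2_sig p) (proj2_sig q));
  sjoin := fun p q => exist _ (pair_join (proj1_sig p) (proj1_sig q))
                        (upper_join c (proj2_sig p) (proj2_sig q));
  smul := fun p q => exist _ (pair_mul (proj1_sig p) (proj1_sig q))
                       (upper_mul c (proj2_sig p) (proj2_sig q));
  simp := fun p q => exist _ (pair_imp (proj1_sig p) (proj1_sig q))
                       (upper_imp c (proj2_sig p) (proj2_sig q));
  st := exist _ (bt, bf) (upper_t c);
  sneg := fun p => exist _ (pair_neg (proj1_sig p)) (upper_neg c (proj2_sig p))
|}.

(* The facts needed for the construction to land in [SM], on objects and on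
   morphisms. *)
Record upper_well_defined : Prop := {
  upper_ob_closed : forall A : bRS_algebra, upper_closed A;
  upper_ob_SM : forall A : bRS_algebra, is_SM (upper_sig (upper_ob_closed A));
  upper_hom_closed : forall (A B : bRS_algebra) (h : bRS_hom A B) (p : A * A),
    in_bowtie p -> in_bowtie (pair_map h p);
  upper_hom_SM : forall (A B : bRS_algebra) (h : bRS_hom A B),
    @is_SM_hom (upper_sig (upper_ob_closed A)) (upper_sig (upper_ob_closed B))
      (restrict (upper_hom_closed h))
}.

Definition upper_ob (w : upper_well_defined) (A : bRS_algebra) : SM_algebra :=
  SMAlgebra (upper_ob_SM w A).

Definition upper_hom (w : upper_well_defined) (A B : bRS_algebra)
    (h : bRS_hom A B) : SM_hom (upper_ob w A) (upper_ob w B) :=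
  @SMHom (upper_ob w A) (upper_ob w B) _ (upper_hom_SM w h).

Definition bowtie_upper (w : upper_well_defined) : assignment bRSA SM :=
  @Assignment bRSA SM (upper_ob w) (upper_hom w).

(* Main.v *)
(** A bRS-algebra is separated by its points: the total preorders induced by
    its prime filters, in which an implication is either the top or its
    conclusion and in which every element is the top or lies below [f].
    At a point, every pair in the bowtie construction has a top component, so
    that the pairs form a chain with an antitone involution; on it the product
    [p] ⊙ [q] is the meet when [p <= ~q] and the join otherwise.  This
    description gives all the laws of Sugihara monoids.

    Conversely, let [S] be a Sugihara monoid.  Every point of its negative cone
    extends to [S], by comparing [x] and [y] through the element
    [(x -> y) /\ t].  Idempotence forces the product of [S] to have, in the
    extended preorder, the same description by meet and join, so the
    order embedding [x |-> (x /\ t, ~x /\ t)] is multiplicative.  Its inverse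
    is [(a, b) |-> a . ~b].  On the other side, a pair [(a, b)] below [(t, f)]
    satisfies [b = a -> f], so its first component determines it. *)

From Stdlib Require Import Classical ProofIrrelevance FunctionalExtensionality.
From Stdlib Require Import Setoid Morphisms.
From mathcomp Require classical_sets.
Require Import Defs.

Set Implicit Arguments.
Unset Strict Implicit.

Local Open Scope bRS_scope.

(** * Order and residuation in Brouwerian algebras *)

Section Brouwerian.

Variable A : bRS_sig.
Hypothesis HA : is_Brouwerian A.

Let L := Brouwerian_lattice HA.

Lemma ble_refl (a : A) : a ⊑ a.
Proof.
  unfold ble. rewrite <- (join_meetK L a a) at 2. apply (meet_joinK L).
Qed.

Lemma ble_trans (a b c : A) : a ⊑ b -> b ⊑ c -> a ⊑ c.
Proof.
  unfold ble; intros Hab Hbc. now rewrite <- Hab, <- (meetA L), Hbc.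
Qed.

Lemma ble_antisym (a b : A) : a ⊑ b -> b ⊑ a -> a = b.
Proof. unfold ble; intros Hab Hba. now rewrite <- Hab, (meetC L), Hba. Qed.

Lemma ble_meetl (a b : A) : a ⊓ b ⊑ a.
Proof.
  unfold ble.
  rewrite (meetC L a b), <- (meetA L), (ble_refl a : a ⊓ a = a). reflexivity.
Qed.

Lemma ble_meetr (a b : A) : a ⊓ b ⊑ b.
Proof. rewrite (meetC L). apply ble_meetl. Qed.

Lemma ble_meet (a b c : A) : c ⊑ a -> c ⊑ b -> c ⊑ a ⊓ b.
Proof. unfold ble; intros Ha Hb. now rewrite (meetA L), Ha. Qed.

Lemma ble_joinl (a b : A) : a ⊑ a ⊔ b.
Proof. apply (meet_joinK L). Qed.

Lemma ble_joinr (a b : A) : b ⊑ a ⊔ b.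
Proof. rewrite (joinC L). apply ble_joinl. Qed.

Lemma ble_join (a b c : A) : a ⊑ c -> b ⊑ c -> a ⊔ b ⊑ c.
Proof.
  assert (E : forall x y : A, x ⊑ y -> x ⊔ y = y).
  { intros x y H. rewrite <- H, (joinC L), (meetC L). apply (join_meetK L). }
  intros Ha Hb. rewrite <- (E _ _ Ha), <- (E _ _ Hb), (joinA L). apply ble_joinl.
Qed.

Lemma bimp_mp (a b : A) : (a ⇀ b) ⊓ a ⊑ b.
Proof. apply (Brouwerian_residuation HA), ble_refl. Qed.

Lemma bimp_weak (a b : A) : b ⊑ a ⇀ b.
Proof. apply (Brouwerian_residuation HA), ble_meetl. Qed.

Lemma ble_top (a : A) : a ⊑ bt.
Proof. apply (Brouwerian_top HA). Qed.

Lemma top_ble (a : A) : bt ⊑ a -> a = bt.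
Proof. intros H; apply ble_antisym; [apply ble_top | exact H]. Qed.

Lemma bimp_top (a b : A) : a ⊑ b -> a ⇀ b = bt.
Proof.
  intros H. apply top_ble, (Brouwerian_residuation HA).
  eapply ble_trans; [apply ble_meetr | exact H].
Qed.

Lemma ble_meet_join (a b c d : A) :
  a ⊓ b ⊑ d -> a ⊓ c ⊑ d -> a ⊓ (b ⊔ c) ⊑ d.
Proof.
  intros Hb Hc. rewrite (meetC L). apply (Brouwerian_residuation HA).
  apply ble_join; apply (Brouwerian_residuation HA); now rewrite (meetC L).
Qed.

End Brouwerian.

(** * The prime filter theorem *)

Record is_prime_filter (A : bRS_sig) (F : A -> Prop) : Prop := {
  filter_top : F bt;
  filter_up : forall a b, F a -> a ⊑ b -> F b;
  filter_meet : forall a b, F a -> F b -> F (a ⊓ b);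
  filter_prime : forall a b, F (a ⊔ b) -> F a \/ F b
}.

Section PrimeFilter.

Variable A : bRS_sig.
Hypothesis HA : is_Brouwerian A.

(** A filter maximal among those omitting [g] is prime: if it contains neither [a] nor [b], it has
    members [c], [d] with [c ⊓ a ⊑ g] and [d ⊓ b ⊑ g], and distributivity gives
    [(c ⊓ d) ⊓ (a ⊔ b) ⊑ g]. *)
Lemma prime_filter_avoiding (g : A) :
  g <> bt -> exists F : A -> Prop, is_prime_filter F /\ ~ F g.
Proof.
  intros Hg.
  (* The empty set is admitted here, so that a union of a chain is admissible. *)
  pose (ok := fun F : A -> Prop =>
    (forall a b, F a -> a ⊑ b -> F b) /\
    (forall a b, F a -> F b -> F (a ⊓ b)) /\ ~ F g).
  destruct (@classical_sets.Zorn_bigcup A ok) as [F [[Fup [Fm Fg]] Hmax]].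
  - intros C HC Htot. split; [|split].
    + intros a b [X CX Xa] Hab. exists X; trivial.
      destruct (HC _ CX) as [Hup _]. now apply Hup with a.
    + intros a b [X CX Xa] [Y CY Yb].
      destruct (Htot _ _ CX CY) as [H | H].
      * exists Y; trivial. apply (HC _ CY); [apply H|]; trivial.
      * exists X; trivial. apply (HC _ CX); [|apply H]; trivial.
    + intros [X CX Xg]. now apply (HC _ CX).
  - assert (max : forall G, ok G -> (forall a, F a -> G a) -> forall a, G a -> F a).
    { intros G HG HFG. apply NNPP; intros H. now apply (Hmax G). }
    (* A maximal set is nonempty, because the singleton of [bt] is admissible: [g] differs from
       [bt]. *)
    assert (Ft : F bt).
    { apply NNPP; intros Hno.
      assert (empty : forall a, ~ F a).
      { intros a Fa. apply Hno, Fup with a; [trivial | apply ble_top, HA]. }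
      apply Hno, (max (fun a => a = bt)); trivial.
      - split; [|split]; trivial.
        + intros a b -> Hab. now apply top_ble.
        + intros a b -> ->. apply ble_refl, HA.
      - intros a Fa. now destruct (empty a). }
    exists F. split; [|trivial]. split; trivial.
    (* The filter generated by [F] and [u] extends [F]; if it omitted [g], maximality would put [u]
       in [F]. *)
    assert (ext : forall u, ~ F u -> exists c, F c /\ c ⊓ u ⊑ g).
    { intros u Hu. apply NNPP; intros Hno. apply Hu.
      apply (max (fun a => exists c, F c /\ c ⊓ u ⊑ a)).
      - split; [|split].
        + intros a b [c [Fc Hc]] Hab. exists c. split; [trivial|].
          now apply ble_trans with a.
        + intros a b [c [Fc Hc]] [d [Fd Hd]]. exists (c ⊓ d).
          split; [now apply Fm|].
          apply ble_meet; [exact HA | |].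
          * apply ble_trans with (c ⊓ u); trivial.
            apply ble_meet; [exact HA | | now apply ble_meetr].
            apply ble_trans with (c ⊓ d); trivial; now apply ble_meetl.
          * apply ble_trans with (d ⊓ u); trivial.
            apply ble_meet; [exact HA | | now apply ble_meetr].
            apply ble_trans with (c ⊓ d);
              [exact HA | now apply ble_meetl | now apply ble_meetr].
        + exact Hno.
      - intros a Fa. exists a. split; [exact Fa | now apply ble_meetl].
      - exists bt. split; [trivial | now apply ble_meetr]. }
    intros a b Fab. apply NNPP; intros Hno.
    destruct (ext a) as [c [Fc Hc]]; [tauto|].
    destruct (ext b) as [d [Fd Hd]]; [tauto|].
    apply Fg, Fup with ((c ⊓ d) ⊓ (a ⊔ b)); [now repeat apply Fm|].
    apply ble_meet_join; [exact HA | |].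
    + apply ble_trans with (c ⊓ a); trivial.
      apply ble_meet; [exact HA | | now apply ble_meetr].
      apply ble_trans with (c ⊓ d); trivial; now apply ble_meetl.
    + apply ble_trans with (d ⊓ b); trivial.
      apply ble_meet; [exact HA | | now apply ble_meetr].
      apply ble_trans with (c ⊓ d);
        [exact HA | now apply ble_meetl | now apply ble_meetr].
Qed.

End PrimeFilter.

(** * Points of a bRS-algebra *)

(** A homomorphism onto a totally ordered bRS-algebra, encoded by the preorder it pulls back so that
    no quotient has to be formed. *)
Record is_point (A : bRS_sig) (le : A -> A -> Prop) : Prop := {
  pt_refl : forall a, le a a;
  pt_trans : forall a b c, le a b -> le b c -> le a c;
  pt_total : forall a b, le a b \/ le b a;
  pt_meet : forall a b c, le c (a ⊓ b) <-> le c a /\ le c b;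
  pt_join : forall a b c, le (a ⊔ b) c <-> le a c /\ le b c;
  pt_imp : forall a b c, le (a ⊓ b) c <-> le a (b ⇀ c);
  pt_top : forall a, le a bt;
  pt_f : forall a, le bt a \/ le a bf
}.

(** This is the order of the quotient by [F]. Totality comes from prelinearity and primality, the
    clause on [bf] from primality and [a ⊔ (a ⇀ bf) = bt]. *)
Lemma point_of_prime_filter (A : bRS_sig) (HA : is_bRS A) (F : A -> Prop) :
  is_prime_filter F -> is_point (fun a b => F (a ⇀ b)).
Proof.
  intros HF. destruct HA as [[HB Hlin] Hf].
  pose proof (Brouwerian_residuation HB) as Hres.
  (* A clause with two premises reduces to an inequality in [A] in which both premises appear as
     elements. *)
  assert (K : forall u v x y, F u -> F v -> u ⊓ v ⊓ x ⊑ y -> F (x ⇀ y)).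
  { intros u v x y Fu Fv H. apply (filter_up HF) with (u ⊓ v).
    - now apply (filter_meet HF).
    - apply (proj1 (Hres _ _ _)), H. }
  assert (I : forall x y, x ⊑ y -> F (x ⇀ y)).
  { intros x y H. rewrite (bimp_top HB H). apply (filter_top HF). }
  assert (M1 : forall u v x y : A, u ⊓ x ⊑ y -> u ⊓ v ⊓ x ⊑ y).
  { intros u v x y H. apply (ble_trans HB) with (u ⊓ x); trivial.
    apply (ble_meet HB); [|apply (ble_meetr HB)].
    apply (ble_trans HB) with (u ⊓ v); apply (ble_meetl HB). }
  assert (M2 : forall u v x y : A, v ⊓ x ⊑ y -> u ⊓ v ⊓ x ⊑ y).
  { intros u v x y. rewrite (meetC (Brouwerian_lattice HB) u). apply M1. }
  assert (T : forall a b c, F (a ⇀ b) -> F (b ⇀ c) -> F (a ⇀ c)).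
  { intros a b c H1 H2. apply (K _ _ _ _ H1 H2).
    apply (ble_trans HB) with ((b ⇀ c) ⊓ b); [|apply (bimp_mp HB)].
    apply (ble_meet HB).
    - apply (ble_trans HB) with ((a ⇀ b) ⊓ (b ⇀ c));
        [apply (ble_meetl HB) | apply (ble_meetr HB)].
    - apply M1, (bimp_mp HB). }
  split.
  - intros a. apply I, (ble_refl HB).
  - exact T.
  - intros a b. apply (filter_prime HF). rewrite Hlin. apply (filter_top HF).
  - intros a b c. split.
    + intros H. split; apply (T _ _ _ H), I.
      * apply (ble_meetl HB).
      * apply (ble_meetr HB).
    + intros [H1 H2]. apply (K _ _ _ _ H1 H2). apply (ble_meet HB).
      * apply M1, (bimp_mp HB).
      * apply M2, (bimp_mp HB).
  - intros a b c. split.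
    + intros H. split; refine (T _ _ _ _ H); apply I.
      * apply (ble_joinl HB).
      * apply (ble_joinr HB).
    + intros [H1 H2]. apply (K _ _ _ _ H1 H2).
      apply (ble_meet_join HB).
      * apply M1, (bimp_mp HB).
      * apply M2, (bimp_mp HB).
  - intros a b c. pose proof (meetA (Brouwerian_lattice HB)) as mA. split; intros H.
    + apply (filter_up HF) with (1 := H).
      apply (proj1 (Hres _ _ _)), (proj1 (Hres _ _ _)).
      rewrite <- mA. apply (bimp_mp HB).
    + apply (filter_up HF) with (1 := H). apply (proj1 (Hres _ _ _)).
      rewrite mA. apply (proj2 (Hres _ _ _)), (bimp_mp HB).
  - intros a. apply I, (ble_top HB).
  - intros a. destruct (filter_prime HF (a := a) (b := a ⇀ bf)) as [H | H].
    + rewrite Hf. apply (filter_top HF).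
    + left. apply (filter_up HF) with (1 := H). apply (bimp_weak HB).
    + now right.
Qed.

(** If [a ⇀ b] is not the top, a prime filter omitting it induces a point at which [a] is not below
    [b]. *)
Lemma ble_of_points (A : bRS_sig) (HA : is_bRS A) (a b : A) :
  (forall le, is_point le -> le a b) -> a ⊑ b.
Proof.
  intros H. pose proof (relative_Stone_Brouwerian (bRS_relative_Stone HA)) as HB.
  destruct (classic (a ⇀ b = bt)) as [E | E].
  - apply (ble_trans HB) with (bt ⊓ a).
    + apply (ble_meet HB); [apply (ble_top HB) | apply (ble_refl HB)].
    + apply (Brouwerian_residuation HB). rewrite E. apply (ble_refl HB).
  - destruct (prime_filter_avoiding HB E) as [F [HF Fab]].
    destruct Fab. exact (H _ (point_of_prime_filter HA HF)).
Qed.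

Lemma eq_of_points (A : bRS_sig) (HA : is_bRS A) (a b : A) :
  (forall le, is_point le -> le a b /\ le b a) -> a = b.
Proof.
  intros H. apply (ble_antisym (relative_Stone_Brouwerian (bRS_relative_Stone HA)));
    apply (ble_of_points HA); intros le Hle; destruct (H le Hle); trivial.
Qed.

(** * Computing the connectives at a point *)

Section Point.

Variables (A : bRS_sig) (le : A -> A -> Prop).
Hypothesis Hle : is_point le.

Lemma pt_of_ble (a b : A) : a ⊑ b -> le a b.
Proof.
  intros H. apply (pt_meet Hle a b a). unfold ble in H. rewrite H.
  apply (pt_refl Hle).
Qed.

(** By totality a meet is equivalent to one of its arguments. Rules of this kind turn inequalities
    between terms into Boolean combinations of inequalities between variables. *)
Lemma pt_meet_le (a b c : A) : le (a ⊓ b) c <-> le a c \/ le b c.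
Proof.
  pose proof (pt_refl Hle) as R; pose proof (pt_trans Hle) as T.
  pose proof (proj1 (pt_meet Hle a b (a ⊓ b)) (R _)) as [Ha Hb].
  split; [intros H | intros [H | H]; eauto].
  destruct (pt_total Hle a b); [left | right];
    refine (T _ _ _ _ H); apply (pt_meet Hle); auto.
Qed.

Lemma pt_le_join (a b c : A) : le c (a ⊔ b) <-> le c a \/ le c b.
Proof.
  pose proof (pt_refl Hle) as R; pose proof (pt_trans Hle) as T.
  pose proof (proj1 (pt_join Hle a b (a ⊔ b)) (R _)) as [Ha Hb].
  split; [intros H | intros [H | H]; eauto].
  destruct (pt_total Hle a b); [right | left];
    apply (T _ _ _ H); apply (pt_join Hle); auto.
Qed.

Lemma pt_le_imp (a b c : A) : le c (a ⇀ b) <-> le c b \/ le a b.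
Proof. rewrite <- (pt_imp Hle). apply pt_meet_le. Qed.

(** In a chain [a ⇀ b] is the top if [a] is below [b], and [b] otherwise. *)
Lemma pt_imp_le (a b c : A) : le (a ⇀ b) c <-> le bt c \/ (~ le a b /\ le b c).
Proof.
  pose proof (pt_refl Hle) as R; pose proof (pt_trans Hle) as T.
  pose proof (proj1 (pt_le_imp a b (a ⇀ b)) (R _)).
  split.
  - intros H1. destruct (classic (le a b)) as [H2 | H2].
    + left. refine (T _ _ _ _ H1). apply pt_le_imp. auto.
    + right. split; trivial. refine (T _ _ _ _ H1). apply pt_le_imp. auto.
  - intros [H1 | [H1 H2]].
    + apply (T _ bt); [apply (pt_top Hle) | trivial].
    + destruct H as [H | H]; [eauto | tauto].
Qed.

Definition pair_le (p q : A * A) : Prop := le (fst p) (fst q) /\ le (snd q) (snd p).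

Definition pair_eqv (p q : A * A) : Prop := pair_le p q /\ pair_le q p.

Definition pt_bowtie (p : A * A) : Prop :=
  (le bt (fst p) /\ le (snd p) bf) \/ (le bt (snd p) /\ le (fst p) bf).

(** If one component is both top and below [bf], then everything is below [bf], in particular the
    other component. *)
Lemma pt_bowtieP (a b : A) :
  pt_bowtie (a, b) <-> le bt (a ⊔ b) /\ le (a ⊓ b) bf.
Proof.
  pose proof (pt_trans Hle) as T. pose proof (pt_top Hle) as Tp.
  unfold pt_bowtie; simpl. rewrite pt_le_join, pt_meet_le.
  split; [tauto|]. intros [[H1 | H1] [H2 | H2]]; auto.
  - left; split; trivial. eauto.
  - right; split; trivial. eauto.
Qed.

End Point.

(** * Tactics deciding inequalities at a point *)

Ltac pt_saturate Hle :=
  repeat match goal with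
  | H1 : ?le ?a ?b, H2 : ?le ?b ?c |- _ =>
      match type of Hle with is_point le => idtac end;
      lazymatch goal with
      | _ : le a c |- _ => fail
      | _ => pose proof (pt_trans Hle H1 H2)
      end
  end.

Ltac pt_refute Hle H :=
  repeat (first
    [ rewrite (pt_meet Hle) in H | rewrite (pt_join Hle) in H
    | rewrite (pt_meet_le Hle) in H | rewrite (pt_le_join Hle) in H
    | rewrite (pt_le_imp Hle) in H | rewrite (pt_imp_le Hle) in H ]);
  repeat match goal with
  | H : _ /\ _ |- _ => destruct H
  | H : _ \/ _ |- _ => destruct H
  end;
  first [contradiction | tauto].

Ltac pt_solve Hle :=
  first
  [ assumption
  | lazymatch goal with
    | |- _ /\ _ => split; pt_solve Hle
    | |- _ \/ _ => first [left; pt_solve Hle | right; pt_solve Hle]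
    | |- ~ _ => let H := fresh in intros H; pt_refute Hle H
    | |- _ (_ ⊔ _) _ => apply (pt_join Hle); pt_solve Hle
    | |- _ _ (_ ⊓ _) => apply (pt_meet Hle); pt_solve Hle
    | |- _ (_ ⊓ _) _ => apply (pt_meet_le Hle); pt_solve Hle
    | |- _ _ (_ ⊔ _) => apply (pt_le_join Hle); pt_solve Hle
    | |- _ _ (_ ⇀ _) => apply (pt_le_imp Hle); pt_solve Hle
    | |- _ (_ ⇀ _) _ => apply (pt_imp_le Hle); pt_solve Hle
    end ].

Ltac pt_split Hle le a b :=
  lazymatch goal with
  | _ : le a b |- _ => idtac
  | _ : ~ le a b |- _ => idtac
  | _ =>
    let H := fresh in
    destruct (classic (le a b)) as [H | H];
    [ pt_saturate Hle
    | let H' := fresh in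
      assert (H' : le b a)
        by (destruct (pt_total Hle a b); [contradiction | assumption]);
      pt_saturate Hle ];
    try contradiction
  end.

(** Runs through the relative orders of four elements, [bf] and [bt]. Afterwards each atomic
    inequality among them is affirmed or denied by a hypothesis, so [pt_solve] only has to unfold
    the connectives. *)
Ltac pt_cases A le Hle a b c d :=
  let pair x y := (pt_split Hle le x y; pt_split Hle le y x) in
  let ends x :=
    (pose proof (pt_top Hle x); pose proof (pt_refl Hle x)) in
  ends (@bf A); ends (@bt A); ends a; ends b; ends c; ends d;
  pt_saturate Hle;
  pair (@bt A) (@bf A); pair a b; pair c d; pair a d; pair b c; pair a c; pair b d;
  pair (@bt A) a; pair (@bt A) b; pair (@bt A) c; pair (@bt A) d;
  pair (@bf A) a; pair (@bf A) b; pair (@bf A) c; pair (@bf A) d.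

(** * Product and implication of pairs at a point *)

Section PointMul.

Variables (A : bRS_sig) (le : A -> A -> Prop).
Hypothesis Hle : is_point le.

(** The four components, [bf] and [bt] lie in a chain on which every connective is computed, so this
    is a finite check over their relative orders. *)
Lemma pair_mul_spec (p q : A * A) :
  pt_bowtie le p -> pt_bowtie le q ->
  (pair_le le p (pair_neg q) /\ pair_eqv le (pair_mul p q) (pair_meet p q)) \/
  (~ pair_le le p (pair_neg q) /\ pair_eqv le (pair_mul p q) (pair_join p q)).
Proof.
  destruct p as [a b], q as [c d].
  unfold pt_bowtie, pair_eqv, pair_le, pair_mul, bN; simpl; unfold bN.
  intros [[Ha Hb] | [Hb Ha]] [[Hc Hd] | [Hd Hc]].
  all: pt_cases A le Hle a b c d.
  all: pt_solve Hle.
Qed.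

Lemma pair_imp_spec (p q : A * A) :
  pt_bowtie le p -> pt_bowtie le q ->
  pair_eqv le (pair_imp p q) (pair_neg (pair_mul p (pair_neg q))).
Proof.
  destruct p as [a b], q as [c d].
  unfold pt_bowtie, pair_eqv, pair_le, pair_mul, pair_imp, bN; simpl; unfold bN.
  intros [[Ha Hb] | [Hb Ha]] [[Hc Hd] | [Hd Hc]].
  all: pt_cases A le Hle a b c d.
  all: pt_solve Hle.
Qed.

End PointMul.

(** * Sugihara chains *)

(** Again a preorder in place of a quotient chain. The product is given by its meet-or-join rule
    alone, from which associativity, unit and residuation are derived. Involutivity is an equation
    in [S], so that double negations can be rewritten. *)
Record is_schain (S : SM_sig) (le : S -> S -> Prop) : Prop := {
  sc_refl : forall x, le x x;
  sc_trans : forall x y z, le x y -> le y z -> le x z;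
  sc_total : forall x y, le x y \/ le y x;
  sc_meet : forall x y z, le z (smeet x y) <-> le z x /\ le z y;
  sc_join : forall x y z, le (sjoin x y) z <-> le x z /\ le y z;
  sc_neg : forall x y, le x y -> le (sneg y) (sneg x);
  sc_negK : forall x : S, sneg (sneg x) = x;
  sc_f_le_t : le (sneg st) st;
  sc_coatom : forall x, le st x \/ le x (sneg st);
  sc_mul : forall x y,
    (le x (sneg y) /\ le (smul x y) (smeet x y) /\ le (smeet x y) (smul x y)) \/
    (~ le x (sneg y) /\ le (smul x y) (sjoin x y) /\ le (sjoin x y) (smul x y));
  sc_imp : forall x y,
    le (simp x y) (sneg (smul x (sneg y))) /\ le (sneg (smul x (sneg y))) (simp x y)
}.

Section SChain.

Variables (S : SM_sig) (le : S -> S -> Prop).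
Hypothesis Hle : is_schain le.

Definition sc_eqv (x y : S) : Prop := le x y /\ le y x.

Lemma sc_of_sle (x y : S) : sle x y -> le x y.
Proof.
  unfold sle; intros H. apply (sc_meet Hle x y x). rewrite H. apply (sc_refl Hle).
Qed.

Lemma sc_meet_le (x y z : S) : le (smeet x y) z <-> le x z \/ le y z.
Proof.
  pose proof (sc_refl Hle) as R; pose proof (sc_trans Hle) as T.
  pose proof (proj1 (sc_meet Hle x y (smeet x y)) (R _)) as [Hx Hy].
  split; [intros H | intros [H | H]; eauto].
  destruct (sc_total Hle x y); [left | right];
    refine (T _ _ _ _ H); apply (sc_meet Hle); auto.
Qed.

Lemma sc_le_join (x y z : S) : le z (sjoin x y) <-> le z x \/ le z y.
Proof.
  pose proof (sc_refl Hle) as R; pose proof (sc_trans Hle) as T.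
  pose proof (proj1 (sc_join Hle x y (sjoin x y)) (R _)) as [Hx Hy].
  split; [intros H | intros [H | H]; eauto].
  destruct (sc_total Hle x y); [right | left];
    apply (T _ _ _ H); apply (sc_join Hle); auto.
Qed.

Lemma sc_neg_r (x y : S) : le x (sneg y) -> le y (sneg x).
Proof. intros H. rewrite <- (sc_negK Hle y). now apply (sc_neg Hle). Qed.

Lemma sc_neg_l (x y : S) : le (sneg x) y -> le (sneg y) x.
Proof. intros H. rewrite <- (sc_negK Hle x). now apply (sc_neg Hle). Qed.

(** Every product is equivalent to one of its factors: the smaller one if [le x (sneg y)], the
    larger one otherwise. *)
Lemma sc_mul_cases (x y : S) :
  (le x y /\ le x (sneg y) /\ sc_eqv (smul x y) x) \/
  (le y x /\ le x (sneg y) /\ sc_eqv (smul x y) y) \/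
  (le y x /\ ~ le x (sneg y) /\ sc_eqv (smul x y) x) \/
  (le x y /\ ~ le x (sneg y) /\ sc_eqv (smul x y) y).
Proof.
  pose proof (sc_refl Hle) as R; pose proof (sc_trans Hle) as T.
  destruct (sc_mul Hle x y) as [[H [H1 H2]] | [H [H1 H2]]];
  destruct (sc_total Hle x y) as [Hxy | Hxy];
    [left | right; left | do 3 right | do 2 right; left];
    (split; [trivial | split; [trivial|]]);
    split.
  all: first [refine (T _ _ _ H1 _) | refine (T _ _ _ _ H2)].
  all: rewrite ?(sc_meet Hle), ?sc_meet_le, ?(sc_join Hle), ?sc_le_join; auto.
Qed.

(** The condition [le x (sneg y)] is symmetric, as negation is an antitone involution. *)
Lemma sc_mulC (x y : S) : sc_eqv (smul x y) (smul y x).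
Proof.
  pose proof (sc_trans Hle) as T; pose proof (@sc_neg_r) as N.
  destruct (sc_mul_cases x y)
    as [[? [? [? ?]]] | [[? [? [? ?]]] | [[? [? [? ?]]] | [? [? [? ?]]]]]];
  destruct (sc_mul_cases y x)
    as [[? [? [? ?]]] | [[? [? [? ?]]] | [[? [? [? ?]]] | [? [? [? ?]]]]]];
  split; try solve [exfalso; eauto | eauto 5].
Qed.

End SChain.

(** * Saturation under transitivity and contraposition *)

Ltac sc_saturate Hle :=
  repeat match goal with
  | H1 : ?le ?a ?b, H2 : ?le ?b ?c |- _ =>
      match type of Hle with is_schain le => idtac end;
      lazymatch goal with
      | _ : le a c |- _ => fail
      | _ => pose proof (sc_trans Hle H1 H2)
      end
  | H : ?le ?a ?b |- _ =>
      match type of Hle with is_schain le => idtac end;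
      lazymatch a with
      | sneg ?a' =>
        lazymatch b with
        | sneg ?b' => lazymatch goal with
            | _ : le b' a' |- _ => fail
            | _ => let H' := fresh in
                pose proof (sc_neg_l Hle H) as H'; rewrite (sc_negK Hle) in H'
            end
        | _ => lazymatch goal with
            | _ : le (sneg b) a' |- _ => fail
            | _ => pose proof (sc_neg_l Hle H)
            end
        end
      | _ =>
        lazymatch b with
        | sneg ?b' => lazymatch goal with
            | _ : le b' (sneg a) |- _ => fail
            | _ => pose proof (sc_neg_r Hle H)
            end
        | _ => lazymatch goal with
            | _ : le (sneg b) (sneg a) |- _ => fail
            | _ => pose proof (sc_neg Hle H)
            end
        end
      end
  end; try contradiction; try assumption.

Ltac sc_mul_destruct Hle x y :=
  destruct (sc_mul_cases Hle x y)
    as [[? [? [? ?]]] | [[? [? [? ?]]] | [[? [? [? ?]]] | [? [? [? ?]]]]]].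

Ltac sc_gt Hle le :=
  repeat match goal with
  | H : ~ le ?x ?y |- _ =>
      lazymatch goal with
      | _ : le y x |- _ => fail
      | _ => assert (le y x)
              by (destruct (sc_total Hle x y); [contradiction | assumption])
      end
  end.

(** * The laws of the product in a Sugihara chain *)

Section SChainLaws.

Variables (S : SM_sig) (le : S -> S -> Prop).
Hypothesis Hle : is_schain le.

Lemma sc_mul_mono_l (x y z : S) : le x y -> le (smul x z) (smul y z).
Proof.
  intros H.
  sc_mul_destruct Hle x z; sc_mul_destruct Hle y z; sc_gt Hle le; sc_saturate Hle.
Qed.

Lemma sc_mul_mono_r (x y z : S) : le x y -> le (smul z x) (smul z y).
Proof.
  intros H. apply (sc_trans Hle) with (smul x z); [apply (sc_mulC Hle)|].
  apply (sc_trans Hle) with (smul y z); [|apply (sc_mulC Hle)].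
  now apply sc_mul_mono_l.
Qed.

(** Absorption becomes a condition on order and negation alone, which saturation can handle. *)
Lemma sc_mul_absorb (x y : S) :
  sc_eqv le (smul x y) x <->
  (le x y /\ le x (sneg y)) \/ (le y x /\ ~ le x (sneg y)).
Proof.
  pose proof (sc_trans Hle) as T.
  sc_mul_destruct Hle x y; (split; [intros [? ?] | intros [[? ?] | [? ?]]; split]);
    try contradiction; try solve [tauto | eauto].
Qed.

Lemma sc_mul_absorb_trans (x y z : S) :
  sc_eqv le (smul x y) x -> sc_eqv le (smul y z) y -> sc_eqv le (smul x z) x.
Proof.
  rewrite !sc_mul_absorb. intros [[H1 H2] | [H1 H2]] [[H3 H4] | [H3 H4]];
    [left | left | right | right]; (split; [|try intros H5]);
    sc_gt Hle le; sc_saturate Hle.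
Qed.

(** Each inner product is equivalent to one of its factors. When [y] absorbs [z] and [x] absorbs
    [y], or [z] absorbs [y] and [y] absorbs [x], transitivity of absorption is needed; the other two
    cases are direct. *)
Lemma sc_mulA (x y z : S) :
  sc_eqv le (smul x (smul y z)) (smul (smul x y) z).
Proof.
  assert (L : forall u v w, sc_eqv le u v -> sc_eqv le (smul w u) (smul w v)).
  { intros u v w [H1 H2]; split; now apply sc_mul_mono_r. }
  assert (R : forall u v w, sc_eqv le u v -> sc_eqv le (smul u w) (smul v w)).
  { intros u v w [H1 H2]; split; now apply sc_mul_mono_l. }
  assert (E : sc_eqv le (smul y z) y \/ sc_eqv le (smul y z) z).
  { destruct (sc_mul_cases Hle y z) as [H | [H | [H | H]]]; tauto. }
  assert (E' : sc_eqv le (smul x y) x \/ sc_eqv le (smul x y) y).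
  { destruct (sc_mul_cases Hle x y) as [H | [H | [H | H]]]; tauto. }
  assert (G : forall u v, sc_eqv le (smul x (smul y z)) u ->
    sc_eqv le (smul (smul x y) z) v -> sc_eqv le u v ->
    sc_eqv le (smul x (smul y z)) (smul (smul x y) z)).
  { intros u v [H1 H2] [H3 H4] [H5 H6]. pose proof (sc_trans Hle). split; eauto. }
  destruct E as [E | E], E' as [E' | E'];
    apply (G _ _ (L _ _ _ E) (R _ _ _ E')).
  - pose proof (sc_mul_absorb_trans E' E) as [H1 H2]. destruct E'.
    pose proof (sc_trans Hle). split; eauto.
  - destruct E, E'. pose proof (sc_trans Hle). split; eauto.
  - split; apply (sc_refl Hle).
  - destruct (@sc_mul_absorb_trans z y x) as [H1 H2].
    + destruct E, (sc_mulC Hle y z). pose proof (sc_trans Hle). split; eauto.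
    + destruct E', (sc_mulC Hle x y). pose proof (sc_trans Hle). split; eauto.
    + destruct E, (sc_mulC Hle x z). pose proof (sc_trans Hle). split; eauto.
Qed.

(** If [x] is below [sneg st], the product is the meet with [st]; otherwise [x] is above [st] and
    the product is the join. Both are [x]. *)
Lemma sc_mul1 (x : S) : sc_eqv le (smul x st) x.
Proof.
  pose proof (sc_f_le_t Hle).
  destruct (sc_coatom Hle x); sc_mul_destruct Hle x (@st S);
    sc_gt Hle le; split; sc_saturate Hle.
Qed.

Lemma sc_mul_idem (x : S) : sc_eqv le (smul x x) x.
Proof. sc_mul_destruct Hle x x; now split. Qed.

Lemma sc_contraposition (x y : S) :
  sc_eqv le (simp x (sneg y)) (simp y (sneg x)).
Proof.
  destruct (sc_imp Hle x (sneg y)) as [H1 H2], (sc_imp Hle y (sneg x)) as [H3 H4].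
  rewrite (sc_negK Hle) in *. destruct (sc_mulC Hle x y) as [H5 H6].
  apply (sc_neg Hle) in H5, H6. pose proof (sc_trans Hle). split; eauto.
Qed.

(** By [M], associativity and [y -> z = ~(y · ~z)], both sides say that [x · y · ~z] lies below
    [sneg st]. *)
Lemma sc_residuation (x y z : S) : le (smul x y) z <-> le x (simp y z).
Proof.
  pose proof (sc_trans Hle) as T.
  assert (M : forall u v, le u (sneg v) <-> le (smul u v) (sneg st)).
  { intros u v. pose proof (sc_f_le_t Hle) as ft.
    destruct (sc_mul Hle u v) as [[H [H1 H2]] | [H [H1 H2]]]; (split; [intros H3|]).
    - apply T with (1 := H1). apply (sc_meet_le Hle).
      destruct (sc_coatom Hle v) as [Hv | Hv]; [left | now right].
      apply T with (1 := H3). now apply (sc_neg Hle).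
    - trivial.
    - contradiction.
    (* The product is the join here, so both factors lie below [sneg st], and [u <= ~t <= ~v] holds
       after all. *)
    - intros H3. destruct H.
      apply T with (1 := H2), (sc_join Hle) in H3. destruct H3 as [Hu Hv].
      apply T with (1 := Hu). apply (sc_neg Hle). now apply T with (1 := Hv). }
  split; intros H.
  - refine (T _ _ _ _ (proj2 (sc_imp Hle y z))).
    apply (proj2 (M _ _)). apply T with (1 := proj1 (sc_mulA x y (sneg z))).
    apply (proj1 (M _ _)). now rewrite (sc_negK Hle).
  - rewrite <- (sc_negK Hle z). apply (proj2 (M _ _)).
    apply T with (1 := proj2 (sc_mulA x y (sneg z))). apply (proj1 (M _ _)).
    exact (T _ _ _ H (proj1 (sc_imp Hle y z))).
Qed.

End SChainLaws.

(** Each law holds up to equivalence in every preorder of [K], and these jointly separate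
    elements. *)
Lemma is_SM_of_schains (S : SM_sig) (K : (S -> S -> Prop) -> Prop) :
  (forall le, K le -> is_schain le) ->
  (forall x y : S, (forall le, K le -> le x y /\ le y x) -> x = y) ->
  (forall x : S, sneg (sneg x) = x) ->
  is_SM S.
Proof.
  intros HK sep negK.
  assert (sepl : forall x y : S, sle x y <-> forall le, K le -> le x y).
  { intros x y; split.
    - intros H le Kle. now apply (sc_of_sle (HK _ Kle)).
    - intros H. apply sep. intros le Kle. pose proof (HK _ Kle) as Hle.
      rewrite (sc_meet Hle), (sc_meet_le Hle).
      pose proof (sc_refl Hle x). pose proof (H le Kle). tauto. }
  assert (R : forall le, K le -> forall x, le x x).
  { intros le Kle. apply (sc_refl (HK _ Kle)). }
  (* Comparing lower sets turns meets and joins into conjunctions and disjunctions, so the lattice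
     laws become tautologies. *)
  assert (L : forall x y : S, (forall le, K le -> forall z, le z x <-> le z y) -> x = y).
  { intros x y H. apply sep. intros le Kle. split; now apply (H _ Kle), R. }
  split.
  - split; intros; apply L; intros le Kle w; pose proof (HK _ Kle) as Hle;
      rewrite ?(sc_meet Hle), ?(sc_le_join Hle), ?(sc_meet Hle), ?(sc_le_join Hle); tauto.
  - intros. apply L. intros le Kle w. pose proof (HK _ Kle) as Hle.
    rewrite ?(sc_meet Hle), ?(sc_le_join Hle), ?(sc_meet Hle). tauto.
  - intros. apply sep. intros le Kle. apply (sc_mulA (HK _ Kle)).
  - intros. apply sep. intros le Kle. apply (sc_mulC (HK _ Kle)).
  - intros. apply sep. intros le Kle. apply (sc_mul1 (HK _ Kle)).
  - intros x y z. rewrite !sepl. split; intros H le Kle;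
      apply (sc_residuation (HK _ Kle)), (H _ Kle).
  - intros. apply sep. intros le Kle. apply (sc_mul_idem (HK _ Kle)).
  - exact negK.
  - intros. apply sep. intros le Kle. apply (sc_contraposition (HK _ Kle)).
Qed.

(** * The Sugihara monoid of a bRS-algebra *)

Lemma sig_eq (T : Type) (P : T -> Prop) (u v : {x | P x}) :
  proj1_sig u = proj1_sig v -> u = v.
Proof.
  destruct u as [x Hx], v as [y Hy]; simpl; intros e; subst y.
  f_equal; apply proof_irrelevance.
Qed.

(** * The chain of pairs at a point *)

Section PointPairs.

Variables (A : bRS_sig) (le : A -> A -> Prop).
Hypothesis Hle : is_point le.

Lemma pt_bowtie_eqv (p q : A * A) :
  pair_eqv le p q -> pt_bowtie le q -> pt_bowtie le p.
Proof.
  pose proof (pt_trans Hle) as T. unfold pt_bowtie.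
  intros [[H1 H2] [H3 H4]] [[H5 H6] | [H5 H6]]; [left | right]; split; eauto.
Qed.

Lemma pt_bowtie_meet (p q : A * A) :
  pt_bowtie le p -> pt_bowtie le q -> pt_bowtie le (pair_meet p q).
Proof.
  destruct p as [a b], q as [c d]; unfold pt_bowtie; simpl.
  rewrite (pt_meet Hle), (pt_meet_le Hle), (pt_join Hle), (pt_le_join Hle). tauto.
Qed.

Lemma pt_bowtie_neg (p : A * A) : pt_bowtie le p -> pt_bowtie le (pair_neg p).
Proof. destruct p; unfold pt_bowtie; simpl. tauto. Qed.

Lemma pt_bowtie_join (p q : A * A) :
  pt_bowtie le p -> pt_bowtie le q -> pt_bowtie le (pair_join p q).
Proof.
  destruct p as [a b], q as [c d]; unfold pt_bowtie; simpl.
  rewrite (pt_meet Hle), (pt_meet_le Hle), (pt_join Hle), (pt_le_join Hle). tauto.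
Qed.

Lemma pt_bowtie_mul (p q : A * A) :
  pt_bowtie le p -> pt_bowtie le q -> pt_bowtie le (pair_mul p q).
Proof.
  intros Hp Hq. destruct (pair_mul_spec Hle Hp Hq) as [[_ E] | [_ E]];
    apply (pt_bowtie_eqv E); [apply pt_bowtie_meet | apply pt_bowtie_join]; trivial.
Qed.

Lemma pt_bowtie_imp (p q : A * A) :
  pt_bowtie le p -> pt_bowtie le q -> pt_bowtie le (pair_imp p q).
Proof.
  intros Hp Hq. apply (pt_bowtie_eqv (pair_imp_spec Hle Hp Hq)).
  apply pt_bowtie_neg, pt_bowtie_mul, pt_bowtie_neg; trivial.
Qed.

(** A pair whose first component is top lies above any pair whose second component is top; pairs of
    the same kind are compared by the remaining component. *)
Lemma pair_le_total (p q : A * A) :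
  pt_bowtie le p -> pt_bowtie le q -> pair_le le p q \/ pair_le le q p.
Proof.
  destruct p as [a b], q as [c d]; unfold pt_bowtie, pair_le; simpl.
  pose proof (pt_trans Hle) as T; pose proof (pt_top Hle) as Tp.
  intros [[Ha Hb] | [Ha Hb]] [[Hc Hd] | [Hc Hd]].
  - destruct (pt_total Hle b d); [right | left]; split; eauto.
  - right. split; eauto.
  - left. split; eauto.
  - destruct (pt_total Hle a c); [left | right]; split; eauto.
Qed.

End PointPairs.

Section Upper.

Variable A : bRS_sig.
Hypothesis HA : is_bRS A.

Let HB := relative_Stone_Brouwerian (bRS_relative_Stone HA).

(** Both defining conditions are inequalities, hence can be tested at points; closure under the
    operations then becomes pointwise. *)
Lemma in_bowtieP (p : A * A) :
  in_bowtie p <-> forall le, is_point le -> pt_bowtie le p.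
Proof.
  destruct p as [a b]; simpl. split.
  - intros [H1 H2] le Hle. apply (pt_bowtieP Hle). split.
    + rewrite H1. apply (pt_refl Hle).
    + now apply (pt_of_ble Hle).
  - intros H. split.
    + apply (top_ble HB), (ble_of_points HA). intros le Hle.
      now apply (pt_bowtieP Hle), H.
    + apply (ble_of_points HA). intros le Hle. now apply (pt_bowtieP Hle), H.
Qed.

Lemma bowtie_closed : upper_closed A.
Proof.
  split; intros *; rewrite ?in_bowtieP.
  - intros Hp Hq le Hle. apply (pt_bowtie_meet Hle); auto.
  - intros Hp Hq le Hle. apply (pt_bowtie_join Hle); auto.
  - intros Hp Hq le Hle. apply (pt_bowtie_mul Hle); auto.
  - intros Hp Hq le Hle. apply (pt_bowtie_imp Hle); auto.
  - intros le Hle. left. split; apply (pt_refl Hle).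
  - intros Hp le Hle. apply pt_bowtie_neg; auto.
Qed.

Lemma pair_eq_of_points (p q : A * A) :
  (forall le, is_point le -> pair_eqv le p q) -> p = q.
Proof.
  destruct p as [a b], q as [c d]; intros H.
  f_equal; apply (eq_of_points HA); intros le Hle;
    destruct (H le Hle) as [[? ?] [? ?]]; now split.
Qed.

Lemma bowtie_schain (c : upper_closed A) (le : A -> A -> Prop) :
  is_point le ->
  @is_schain (upper_sig c) (fun u v => pair_le le (proj1_sig u) (proj1_sig v)).
Proof.
  intros Hle.
  assert (B : forall u : upper_sig c, pt_bowtie le (proj1_sig u)).
  { intros [p Hp]. now apply (proj1 (in_bowtieP p)). }
  split.
  - intros u. split; apply (pt_refl Hle).
  - intros u v w [H1 H2] [H3 H4]. split; eapply (pt_trans Hle); eauto.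
  - intros u v. now apply (pair_le_total Hle).
  - intros [[a a'] ?] [[b b'] ?] [[d d'] ?]. unfold pair_le; simpl.
    rewrite (pt_meet Hle), (pt_join Hle). tauto.
  - intros [[a a'] ?] [[b b'] ?] [[d d'] ?]. unfold pair_le; simpl.
    rewrite (pt_meet Hle), (pt_join Hle). tauto.
  - intros [[a a'] ?] [[b b'] ?] [H1 H2]. now split.
  - intros [[a a'] ?]. now apply sig_eq.
  - split; apply (pt_top Hle).
  - intros u. destruct (B u) as [H | H]; [left | right]; split; simpl;
      destruct u as [[a b] ?]; simpl in *; try tauto; apply (pt_top Hle).
  - intros u v. exact (pair_mul_spec Hle (B u) (B v)).
  - intros u v. exact (pair_imp_spec Hle (B u) (B v)).
Qed.

Lemma bowtie_SM (c : upper_closed A) : is_SM (upper_sig c).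
Proof.
  apply (@is_SM_of_schains (upper_sig c) (fun r => exists le, is_point le /\
    r = fun u v => pair_le le (proj1_sig u) (proj1_sig v))).
  - intros r [le [Hle ->]]. now apply bowtie_schain.
  - intros u v H. apply sig_eq, pair_eq_of_points. intros le Hle.
    apply (H _ (ex_intro _ le (conj Hle eq_refl))).
  - intros [[a b] ?]. now apply sig_eq.
Qed.

End Upper.

Lemma pair_map_bowtie (A B : bRS_sig) (h : A -> B) (Hh : is_bRS_hom h) (p : A * A) :
  in_bowtie p -> in_bowtie (pair_map h p).
Proof.
  destruct p as [a b]; simpl; unfold ble. intros [H1 H2]. split.
  - now rewrite <- (bRS_hom_join Hh), H1, (bRS_hom_t Hh).
  - now rewrite <- (bRS_hom_meet Hh), <- (bRS_hom_f Hh), <- (bRS_hom_meet Hh), H2.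
Qed.

Lemma pair_map_SM_hom (A B : bRS_sig) (h : A -> B) (Hh : is_bRS_hom h)
    (cA : upper_closed A) (cB : upper_closed B)
    (PQ : forall p : A * A, in_bowtie p -> in_bowtie (pair_map h p)) :
  @is_SM_hom (upper_sig cA) (upper_sig cB) (restrict PQ).
Proof.
  split.
  - intros [[a b] ?] [[c d] ?]. apply sig_eq; simpl.
    now rewrite (bRS_hom_meet Hh), (bRS_hom_join Hh).
  - intros [[a b] ?] [[c d] ?]. apply sig_eq; simpl.
    now rewrite (bRS_hom_meet Hh), (bRS_hom_join Hh).
  - intros [[a b] ?] [[c d] ?]. apply sig_eq; simpl. unfold pair_mul; simpl. unfold bN.
    repeat rewrite ?(bRS_hom_meet Hh), ?(bRS_hom_imp Hh), ?(bRS_hom_f Hh).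
    reflexivity.
  - intros [[a b] ?] [[c d] ?]. apply sig_eq; simpl. unfold pair_imp; simpl. unfold bN.
    repeat rewrite ?(bRS_hom_meet Hh), ?(bRS_hom_imp Hh), ?(bRS_hom_f Hh).
    reflexivity.
  - apply sig_eq; simpl. now rewrite (bRS_hom_t Hh), (bRS_hom_f Hh).
  - intros [[a b] ?]. now apply sig_eq.
Qed.

Lemma upper_wd : upper_well_defined.
Proof.
  refine (@Build_upper_well_defined
    (fun A => bowtie_closed (bRS_axioms A))
    (fun A => bowtie_SM (bRS_axioms A) _)
    (fun A B h => pair_map_bowtie (bRS_funP h)) _).
  intros A B h. apply (pair_map_SM_hom (bRS_funP h)).
Qed.

(** * The negative cone of a Sugihara monoid *)

Section Sugihara.

Variable S : SM_sig.
Hypothesis HS : is_SM S.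

Let L := SM_lattice HS.

Local Notation "x ≤ y" := (sle x y) (at level 70, no associativity).
Local Notation "x · y" := (smul x y) (at level 40, left associativity).

Lemma sle_refl (x : S) : x ≤ x.
Proof.
  unfold sle. rewrite <- (join_meetK L x x) at 2. apply (meet_joinK L).
Qed.

Lemma sle_trans (x y z : S) : x ≤ y -> y ≤ z -> x ≤ z.
Proof.
  unfold sle; intros Hxy Hyz. now rewrite <- Hxy, <- (meetA L), Hyz.
Qed.

Lemma sle_antisym (x y : S) : x ≤ y -> y ≤ x -> x = y.
Proof. unfold sle; intros Hxy Hyx. now rewrite <- Hxy, (meetC L), Hyx. Qed.

Lemma smeet_l (x y : S) : smeet x y ≤ x.
Proof.
  unfold sle.
  rewrite (meetC L x y), <- (meetA L), (sle_refl x : smeet x x = x). reflexivity.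
Qed.

Lemma smeet_r (x y : S) : smeet x y ≤ y.
Proof. rewrite (meetC L). apply smeet_l. Qed.

Lemma sle_meet (x y z : S) : z ≤ x -> z ≤ y -> z ≤ smeet x y.
Proof. unfold sle; intros Hx Hy. now rewrite (meetA L), Hx. Qed.

Lemma sjoin_l (x y : S) : x ≤ sjoin x y.
Proof. apply (meet_joinK L). Qed.

Lemma sjoin_r (x y : S) : y ≤ sjoin x y.
Proof. rewrite (joinC L). apply sjoin_l. Qed.

Lemma sjoin_le (x y z : S) : x ≤ z -> y ≤ z -> sjoin x y ≤ z.
Proof.
  assert (E : forall u v : S, u ≤ v -> sjoin u v = v).
  { intros u v H. rewrite <- H, (joinC L), (meetC L). apply (join_meetK L). }
  intros Hx Hy. rewrite <- (E _ _ Hx), <- (E _ _ Hy), (joinA L). apply sjoin_l.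
Qed.

Lemma sres (x y z : S) : x · y ≤ z <-> x ≤ simp y z.
Proof. apply (SM_residuation HS). Qed.

Lemma smul_mono_l (x y z : S) : x ≤ y -> x · z ≤ y · z.
Proof.
  intros H. apply sres. apply sle_trans with (1 := H). apply sres, sle_refl.
Qed.

Lemma smul_mono (x y z w : S) : x ≤ y -> z ≤ w -> x · z ≤ y · w.
Proof.
  intros H1 H2. apply sle_trans with (y · z); [now apply smul_mono_l|].
  rewrite !(SM_mulC HS y). now apply smul_mono_l.
Qed.

Lemma st_mul (x : S) : st · x = x.
Proof. rewrite (SM_mulC HS). apply (SM_mul1 HS). Qed.

Lemma smul_neg_l (c x : S) : c ≤ st -> c · x ≤ x.
Proof. intros H. rewrite <- (st_mul x) at 2. now apply smul_mono_l. Qed.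

(** By idempotence the meet is its own square. *)
Lemma smeet_le_mul (x y : S) : smeet x y ≤ x · y.
Proof.
  rewrite <- (SM_mul_idem HS (smeet x y)).
  apply smul_mono; [apply smeet_l | apply smeet_r].
Qed.

Lemma smul_le_join (x y : S) : x · y ≤ sjoin x y.
Proof.
  rewrite <- (SM_mul_idem HS (sjoin x y)).
  apply smul_mono; [apply sjoin_l | apply sjoin_r].
Qed.

(** This makes the truncated residual the Brouwerian implication of the negative cone. *)
Lemma smul_neg_cone (x y : S) : x ≤ st -> y ≤ st -> x · y = smeet x y.
Proof.
  intros Hx Hy. apply sle_antisym; [|apply smeet_le_mul].
  apply sle_meet; [rewrite (SM_mulC HS)|]; now apply smul_neg_l.
Qed.

Lemma st_imp (x : S) : simp st x = x.
Proof.
  apply sle_antisym.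
  - rewrite <- (SM_mul1 HS (simp st x)). apply sres, sle_refl.
  - apply sres. rewrite (SM_mul1 HS). apply sle_refl.
Qed.

Lemma simp_f (x : S) : simp x (sneg st) = sneg x.
Proof. rewrite (SM_contraposition HS). apply st_imp. Qed.

(** Inequalities become products below [sneg st], where factors can be regrouped freely. *)
Lemma sle_neg (x y : S) : x ≤ sneg y <-> x · y ≤ sneg st.
Proof. rewrite <- simp_f. symmetry. apply sres. Qed.

Lemma smul_le (x y z : S) : x · y ≤ z <-> x · (y · sneg z) ≤ sneg st.
Proof. rewrite (SM_mulA HS), <- sle_neg, (SM_negK HS). reflexivity. Qed.

Lemma sneg_mul (x : S) : x · sneg x ≤ sneg st.
Proof. apply (proj1 (sle_neg _ _)). rewrite (SM_negK HS). apply sle_refl. Qed.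

(** Writing [st] as [~~t], the claim amounts to [~t · ~t <= ~t]. *)
Lemma sneg_st_le : sneg (@st S) ≤ st.
Proof.
  rewrite <- (SM_negK HS st) at 2. apply (proj2 (sle_neg _ _)).
  rewrite (SM_mul_idem HS). apply sle_refl.
Qed.

Lemma sneg_anti (x y : S) : x ≤ y -> sneg y ≤ sneg x.
Proof.
  intros H. apply (proj2 (sle_neg _ _)). apply sle_trans with (sneg y · y).
  - apply smul_mono; [apply sle_refl | trivial].
  - rewrite (SM_mulC HS). apply sneg_mul.
Qed.

Lemma simpE (x y : S) : simp x y = sneg (x · sneg y).
Proof.
  apply sle_antisym.
  - apply (proj2 (sle_neg _ _)), (proj1 (smul_le _ _ _)), sres, sle_refl.
  - apply sres, (proj2 (smul_le _ _ _)), (proj1 (sle_neg _ _)), sle_refl.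
Qed.

(** Dually, [m = ~(x \/ ~x)] lies below [~x] and [x], so [m = m · m <= ~x · x <= ~t]. *)
Lemma excluded_middle_st (x : S) : st ≤ sjoin x (sneg x).
Proof.
  rewrite <- (SM_negK HS (sjoin x (sneg x))), <- (SM_negK HS st) at 1.
  apply sneg_anti. set (m := sneg (sjoin x (sneg x))).
  rewrite <- (SM_mul_idem HS m).
  apply sle_trans with (sneg x · x); [|rewrite (SM_mulC HS); apply sneg_mul].
  apply smul_mono.
  - apply sneg_anti, sjoin_l.
  - rewrite <- (SM_negK HS x). apply sneg_anti, sjoin_r.
Qed.

(* [sneg (x -> y) = x · sneg y] lies below [y -> x] because
   [y · sneg y <= sneg st <= st]; excluded middle then gives prelinearity. *)
Lemma simp_prelinear (x y : S) : st ≤ sjoin (simp x y) (simp y x).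
Proof.
  apply sle_trans with (1 := excluded_middle_st (simp x y)).
  apply sjoin_le; [apply sjoin_l|].
  apply sle_trans with (simp y x); [|apply sjoin_r].
  rewrite (simpE x y), (SM_negK HS). apply (proj1 (sres _ _ _)).
  rewrite <- (SM_mulA HS), (SM_mulC HS x). apply smul_neg_l.
  apply sle_trans with (sneg st); [|apply sneg_st_le].
  rewrite (SM_mulC HS). apply sneg_mul.
Qed.

Lemma st_le_join_neg_cone (x y : S) :
  st ≤ sjoin x y -> sjoin (smeet x st) (smeet y st) = st.
Proof.
  intros H. apply sle_antisym.
  - apply sjoin_le; apply smeet_r.
  - rewrite !(meetC L _ st), <- (SM_distributive HS).
    apply sle_meet; [apply sle_refl | trivial].
Qed.

Lemma neg_cone_closed : lower_closed S.
Proof.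
  unfold in_neg_cone; split; unfold in_neg_cone.
  - intros x y Hx _. apply sle_trans with x; [apply smeet_l | trivial].
  - intros x y. apply sjoin_le.
  - intros x y _ _. apply smeet_r.
  - apply sle_refl.
  - apply sneg_st_le.
Qed.

Lemma lower_ble (c : lower_closed S) (u v : lower_sig c) :
  u ⊑ v <-> proj1_sig u ≤ proj1_sig v.
Proof.
  unfold ble, sle. split; intros H.
  - now apply (f_equal (@proj1_sig _ _)) in H.
  - now apply sig_eq.
Qed.

Lemma neg_cone_bRS (c : lower_closed S) : is_bRS (lower_sig c).
Proof.
  split; [split; [split|]|].
  - split; intros; apply sig_eq; simpl; apply L.
  - intros [x Hx]. now apply lower_ble.
  - intros [x Hx] [y Hy] [z Hz]. rewrite !lower_ble; simpl. unfold neg_imp.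
    rewrite <- (smul_neg_cone Hx Hy), sres. split; intros H.
    + now apply sle_meet.
    + apply sle_trans with (1 := H), smeet_l.
  - intros [x Hx] [y Hy]. apply sig_eq; simpl.
    apply st_le_join_neg_cone, simp_prelinear.
  - intros [x Hx]. apply sig_eq; simpl. unfold neg_imp. rewrite simp_f.
    (* Here [x -> ~t] is [~x]; writing [x] as [x /\ t] leaves excluded middle truncated at [st]. *)
    rewrite <- Hx at 1. apply st_le_join_neg_cone, excluded_middle_st.
Qed.

End Sugihara.

Lemma SM_hom_neg_cone (S T : SM_sig) (h : S -> T) (Hh : is_SM_hom h) (x : S) :
  in_neg_cone x -> in_neg_cone (h x).
Proof.
  unfold in_neg_cone, sle; intros H.
  now rewrite <- (SM_hom_t Hh), <- (SM_hom_meet Hh), H.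
Qed.

Lemma restrict_bRS_hom (S T : SM_sig) (h : S -> T) (Hh : is_SM_hom h)
    (cS : lower_closed S) (cT : lower_closed T)
    (PQ : forall x : S, in_neg_cone x -> in_neg_cone (h x)) :
  @is_bRS_hom (lower_sig cS) (lower_sig cT) (restrict PQ).
Proof.
  split; intros; apply sig_eq; simpl.
  - apply (SM_hom_meet Hh).
  - apply (SM_hom_join Hh).
  - unfold neg_imp. now rewrite (SM_hom_meet Hh), (SM_hom_imp Hh), (SM_hom_t Hh).
  - apply (SM_hom_t Hh).
  - now rewrite (SM_hom_neg Hh), (SM_hom_t Hh).
Qed.

Lemma lower_wd : lower_well_defined.
Proof.
  refine (@Build_lower_well_defined
    (fun S => neg_cone_closed (SM_axioms S))
    (fun S => neg_cone_bRS (SM_axioms S) _)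
    (fun S T h => SM_hom_neg_cone (SM_funP h)) _).
  intros S T h. apply (restrict_bRS_hom (SM_funP h)).
Qed.

(** * The isomorphisms *)

Section Lift.

Variable S : SM_sig.
Hypothesis HS : is_SM S.
Variable c : lower_closed S.

Local Notation "x ≤ y" := (sle x y) (at level 70, no associativity).
Local Notation "x · y" := (smul x y) (at level 40, left associativity).

Definition cone_imp (x y : S) : lower_sig c :=
  exist _ (neg_imp x y) (smeet_r HS (simp x y) st).

Lemma le_cone_imp (u : lower_sig c) (x y : S) :
  u ⊑ cone_imp x y <-> proj1_sig u · x ≤ y.
Proof.
  rewrite (lower_ble u (cone_imp x y)), (sres HS); simpl; unfold neg_imp.
  split; intros H.
  - apply (sle_trans HS) with (1 := H), (smeet_l HS).
  - apply (sle_meet HS); [trivial | apply (proj2_sig u)].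
Qed.

Let HL := neg_cone_bRS HS c.
Let HB := relative_Stone_Brouwerian (bRS_relative_Stone HL).

Variable le : lower_sig c -> lower_sig c -> Prop.
Hypothesis Hle : is_point le.

Definition point_lift (x y : S) : Prop := le bt (cone_imp x y).

(** [cone_imp x y] is the largest [u] in the cone with [u · x ≤ y]. A rule between lifted
    inequalities thus reduces to inequalities in [S] with a parameter [u]. *)
Lemma point_lift1 (x y z w : S) :
  (forall u, u ≤ st -> u · x ≤ y -> u · z ≤ w) ->
  point_lift x y -> point_lift z w.
Proof.
  intros H Hxy. apply (pt_trans Hle) with (1 := Hxy), (pt_of_ble Hle).
  apply le_cone_imp, H; [apply (smeet_r HS)|].
  apply (proj1 (le_cone_imp _ _ _)), (ble_refl HB).
Qed.

Lemma point_lift2 (x1 y1 x2 y2 z w : S) :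
  (forall u, u ≤ st -> u · x1 ≤ y1 -> u · x2 ≤ y2 -> u · z ≤ w) ->
  point_lift x1 y1 -> point_lift x2 y2 -> point_lift z w.
Proof.
  intros H H1 H2. pose proof (conj H1 H2) as H3.
  apply (pt_meet Hle) in H3.
  apply (pt_trans Hle) with (1 := H3), (pt_of_ble Hle).
  apply le_cone_imp, H.
  - exact (proj2_sig (cone_imp x1 y1 ⊓ cone_imp x2 y2)).
  - apply (proj1 (le_cone_imp _ _ _)), (ble_meetl HB).
  - apply (proj1 (le_cone_imp _ _ _)), (ble_meetr HB).
Qed.

Lemma point_lift_of_sle (x y : S) : x ≤ y -> point_lift x y.
Proof.
  intros H. apply (pt_of_ble Hle), le_cone_imp; simpl. now rewrite (st_mul HS).
Qed.

(** On the cone, [cone_imp] is [u ⇀ v], which is top at the point exactly when [le u v]. *)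
Lemma point_lift_cone (u v : lower_sig c) :
  point_lift (proj1_sig u) (proj1_sig v) <-> le u v.
Proof.
  unfold point_lift.
  replace (cone_imp (proj1_sig u) (proj1_sig v)) with (u ⇀ v)
    by now apply sig_eq.
  rewrite (pt_le_imp Hle). split; [intros [H | H]; trivial | now right].
  apply (pt_trans Hle) with bt; [apply (pt_top Hle) | trivial].
Qed.

Lemma point_lift_schain : is_schain point_lift.
Proof.
  pose proof (sle_trans HS) as T.
  assert (Tr : forall x y z, point_lift x y -> point_lift y z -> point_lift x z).
  { intros x y z. apply point_lift2. intros u _ H1 H2.
    (* Idempotence provides one factor [u] for each premise. *)
    rewrite <- (SM_mul_idem HS u), <- (SM_mulA HS).
    refine (T _ _ _ _ H2). now apply (smul_mono HS); [apply (sle_refl HS)|]. }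
  (* At a point a join is top only if one argument is. Prelinearity and excluded middle thereby give
     totality and [C]. *)
  assert (J : forall x1 y1 x2 y2,
    sjoin (neg_imp x1 y1) (neg_imp x2 y2) = st ->
    point_lift x1 y1 \/ point_lift x2 y2).
  { intros x1 y1 x2 y2 H. apply (pt_le_join Hle).
    replace (cone_imp x1 y1 ⊔ cone_imp x2 y2) with (@bt (lower_sig c))
      by (apply sig_eq; simpl; now rewrite H).
    apply (pt_refl Hle). }
  assert (C : forall x, point_lift st x \/ point_lift x (sneg st)).
  { intros x. apply J. unfold neg_imp. rewrite (st_imp HS), (simp_f HS).
    apply (st_le_join_neg_cone HS), (excluded_middle_st HS). }
  split.
  - intros x. apply point_lift_of_sle, (sle_refl HS).
  - exact Tr.
  - intros x y. apply J, (st_le_join_neg_cone HS), (simp_prelinear HS).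
  - intros x y z. split.
    + intros H. split; apply (Tr _ _ _ H), point_lift_of_sle;
        [apply (smeet_l HS) | apply (smeet_r HS)].
    + intros [H1 H2]. revert H1 H2. apply point_lift2.
      intros u _. apply (sle_meet HS).
  - intros x y z. split.
    + intros H. split; refine (Tr _ _ _ _ H); apply point_lift_of_sle;
        [apply (sjoin_l HS) | apply (sjoin_r HS)].
    + intros [H1 H2]. revert H1 H2. apply point_lift2.
      intros u _. rewrite !(SM_mulC HS u), !(sres HS). apply (sjoin_le HS).
  - intros x y. apply point_lift1. intros u _ H.
    apply (proj2 (sle_neg HS _ _)).
    rewrite <- (SM_mulA HS), (SM_mulC HS (sneg y)).
    now apply (proj1 (smul_le HS _ _ _)).
  - apply (SM_negK HS).
  - apply point_lift_of_sle, (sneg_st_le HS).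
  - exact C.
  - intros x y. destruct (classic (point_lift x (sneg y))) as [H | H].
    + left. split; [trivial | split; [|apply point_lift_of_sle, (smeet_le_mul HS)]].
      revert H. apply point_lift1. intros u _ H.
      apply (sle_neg HS) in H.
      (* Since [u · x · y <= ~t <= t], multiplying by it decreases; by idempotence [u · (x · y)]
         equals both [x · (u · x · y)] and [y · (u · x · y)]. *)
      assert (K : forall z, z · (u · x · y) ≤ z).
      { intros z. rewrite (SM_mulC HS). apply (smul_neg_l HS).
        apply T with (1 := H), (sneg_st_le HS). }
      apply (sle_meet HS).
      * apply T with (2 := K x).
        rewrite (SM_mulC HS u x), <- (SM_mulA HS x), (SM_mulA HS x x), (SM_mul_idem HS),
          (SM_mulA HS x u), (SM_mulC HS x u), <- (SM_mulA HS). apply (sle_refl HS).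
      * apply T with (2 := K y).
        rewrite (SM_mulC HS y), <- !(SM_mulA HS), (SM_mul_idem HS). apply (sle_refl HS).
    + right. split; [trivial | split; [apply point_lift_of_sle, (smul_le_join HS)|]].
      (* If [t <= x · y], multiplying by [x] or [y] puts both below [x · y] by idempotence. If
         [x · y <= ~t], then [x <= ~y], which is excluded. *)
      destruct (C (x · y)) as [H1 | H1].
      * revert H1. apply point_lift1. intros u _ H1. rewrite (SM_mul1 HS) in H1.
        rewrite (SM_mulC HS), (sres HS). apply (sjoin_le HS); apply (sres HS).
        -- apply T with (x · (x · y)).
           ++ apply (smul_mono HS); [apply (sle_refl HS) | trivial].
           ++ rewrite (SM_mulA HS), (SM_mul_idem HS). apply (sle_refl HS).
        -- apply T with (y · (x · y)).
           ++ apply (smul_mono HS); [apply (sle_refl HS) | trivial].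
           ++ rewrite (SM_mulC HS x), (SM_mulA HS), (SM_mul_idem HS). apply (sle_refl HS).
      * destruct H. revert H1. apply point_lift1. intros u _ H1.
        apply (proj2 (sle_neg HS _ _)). now rewrite <- (SM_mulA HS).
  - intros x y. rewrite (simpE HS). split; apply point_lift_of_sle, (sle_refl HS).
Qed.

End Lift.

Lemma SM_hom_inverse (S T : SM_sig) (h : S -> T) (g : T -> S) :
  (forall x, g (h x) = x) -> (forall y, h (g y) = y) ->
  is_SM_hom h -> is_SM_hom g.
Proof.
  intros gh hg [H1 H2 H3 H4 H5 H6].
  split; intros; rewrite <- gh, ?H1, ?H2, ?H3, ?H4, ?H5, ?H6, ?hg; reflexivity.
Qed.

Lemma bRS_hom_inverse (A B : bRS_sig) (h : A -> B) (g : B -> A) :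
  (forall x, g (h x) = x) -> (forall y, h (g y) = y) ->
  is_bRS_hom h -> is_bRS_hom g.
Proof.
  intros gh hg [H1 H2 H3 H4 H5].
  split; intros; rewrite <- gh, ?H1, ?H2, ?H3, ?H4, ?H5, ?hg; reflexivity.
Qed.

(** * A Sugihara monoid as the bowtie of its negative cone *)

Section ConePair.

Variable S : SM_sig.
Hypothesis HS : is_SM S.
Variable c : lower_closed S.

Let L := SM_lattice HS.
Let HL := neg_cone_bRS HS c.

Local Notation "x ≤ y" := (sle x y) (at level 70, no associativity).
Local Notation "x · y" := (smul x y) (at level 40, left associativity).

Definition cone_part (x : S) : lower_sig c :=
  exist _ (smeet x st) (smeet_r HS x st).

Definition cone_pair (x : S) : lower_sig c * lower_sig c :=
  (cone_part x, cone_part (sneg x)).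

(** Comparing the components gives [x <= y] at once except when [t <= y] and [t <= ~x]; then
    [~y <= ~t <= t <= ~x]. *)
Lemma cone_pair_le (le : lower_sig c -> lower_sig c -> Prop) (Hle : is_point le)
    (x y : S) :
  pair_le le (cone_pair x) (cone_pair y) <-> point_lift HS le x y.
Proof.
  pose proof (point_lift_schain HS Hle) as Hsc.
  unfold pair_le, cone_pair; simpl.
  rewrite <- !(point_lift_cone HS Hle); simpl.
  rewrite !(sc_meet Hsc), !(sc_meet_le Hsc).
  pose proof (sc_refl Hsc st). pose proof (sc_f_le_t Hsc).
  pose proof (sc_trans Hsc) as T.
  pose proof (sc_neg Hsc (x := x) (y := y)) as N1.
  pose proof (sc_neg Hsc (x := sneg y) (y := sneg x)) as N2.
  rewrite !(SM_negK HS) in N2.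
  pose proof (sc_neg Hsc (x := st) (y := y)) as N3.
  split; [|tauto].
  intros [[[H1 | H1] _] [[H2 | H2] _]]; auto.
  apply N2. apply T with (sneg st); [now apply N3|].
  apply T with st; trivial.
Qed.

Lemma sneg_join (x y : S) : sneg (sjoin x y) = smeet (sneg x) (sneg y).
Proof.
  apply (sle_antisym HS).
  - apply (sle_meet HS); apply (sneg_anti HS); [apply (sjoin_l HS) | apply (sjoin_r HS)].
  - rewrite <- (SM_negK HS (smeet _ _)). apply (sneg_anti HS), (sjoin_le HS).
    + rewrite <- (SM_negK HS x) at 1. apply (sneg_anti HS), (smeet_l HS).
    + rewrite <- (SM_negK HS y) at 1. apply (sneg_anti HS), (smeet_r HS).
Qed.

Lemma sneg_meet (x y : S) : sneg (smeet x y) = sjoin (sneg x) (sneg y).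
Proof. now rewrite <- (SM_negK HS (sjoin _ _)), sneg_join, !(SM_negK HS). Qed.

Lemma cone_part_meet (x y : S) : cone_part (smeet x y) = cone_part x ⊓ cone_part y.
Proof.
  apply sig_eq; simpl. apply (sle_antisym HS).
  - repeat apply (sle_meet HS); try apply (smeet_r HS);
      apply (sle_trans HS) with (smeet x y);
      first [apply (smeet_l HS) | apply (smeet_r HS)].
  - repeat apply (sle_meet HS).
    + apply (sle_trans HS) with (smeet x st); apply (smeet_l HS).
    + apply (sle_trans HS) with (smeet y st); [apply (smeet_r HS) | apply (smeet_l HS)].
    + apply (sle_trans HS) with (smeet x st); [apply (smeet_l HS) | apply (smeet_r HS)].
Qed.

Lemma cone_part_join (x y : S) : cone_part (sjoin x y) = cone_part x ⊔ cone_part y.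
Proof.
  apply sig_eq; simpl. rewrite !(meetC L _ st). apply (SM_distributive HS).
Qed.

Lemma cone_pair_meet (x y : S) :
  cone_pair (smeet x y) = pair_meet (cone_pair x) (cone_pair y).
Proof.
  unfold cone_pair; simpl. now rewrite sneg_meet, cone_part_meet, cone_part_join.
Qed.

Lemma cone_pair_join (x y : S) :
  cone_pair (sjoin x y) = pair_join (cone_pair x) (cone_pair y).
Proof.
  unfold cone_pair; simpl. now rewrite sneg_join, cone_part_meet, cone_part_join.
Qed.

Lemma cone_pair_neg (x : S) : cone_pair (sneg x) = pair_neg (cone_pair x).
Proof. unfold cone_pair; simpl. now rewrite (SM_negK HS). Qed.

Lemma cone_pair_bowtie (x : S) : in_bowtie (cone_pair x).
Proof.
  split.
  - apply sig_eq; simpl. apply (st_le_join_neg_cone HS), (excluded_middle_st HS).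
  - apply lower_ble; simpl.
    apply (sle_trans HS) with (1 := smeet_le_mul HS _ _).
    apply (sle_trans HS) with (x · sneg x); [|apply (sneg_mul HS)].
    apply (smul_mono HS); apply (smeet_l HS).
Qed.

(** At each point both products follow the same meet-or-join rule under the same condition, as
    [cone_pair] respects meet, join, negation and the lifted order. *)
Lemma cone_pair_mul (x y : S) :
  cone_pair (x · y) = pair_mul (cone_pair x) (cone_pair y).
Proof.
  apply (pair_eq_of_points HL). intros le Hle.
  pose proof (point_lift_schain HS Hle) as Hsc.
  assert (T : forall p q r, pair_eqv le p q -> pair_eqv le r q -> pair_eqv le p r).
  { pose proof (pt_trans Hle) as Tr.
    intros p q r [[? ?] [? ?]] [[? ?] [? ?]]. repeat split; eauto. }
  pose proof (pair_mul_spec Hle (p := cone_pair x) (q := cone_pair y)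
    (proj1 (in_bowtieP HL _) (cone_pair_bowtie x) le Hle)
    (proj1 (in_bowtieP HL _) (cone_pair_bowtie y) le Hle)) as H.
  rewrite <- cone_pair_neg, <- cone_pair_meet, <- cone_pair_join,
    (cone_pair_le Hle) in H.
  destruct H as [[H E] | [H E]]; refine (T _ _ _ _ E);
    unfold pair_eqv; rewrite !(cone_pair_le Hle);
    destruct (sc_mul Hsc x y) as [[H1 H2] | [H1 H2]]; tauto.
Qed.

(** The lifts of all points separate [S]: if [u] is below [v] in each, then [bt ⊑ cone_imp u v],
    that is, [u ≤ v]. *)
Lemma cone_pair_inj (x y : S) : cone_pair x = cone_pair y -> x = y.
Proof.
  intros H.
  assert (K : forall le : lower_sig c -> lower_sig c -> Prop, is_point le ->
    point_lift HS le x y /\ point_lift HS le y x).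
  { intros le Hle. rewrite <- !(cone_pair_le Hle), H.
    repeat split; apply (pt_refl Hle). }
  assert (I : forall u v, (forall le : lower_sig c -> lower_sig c -> Prop,
    is_point le -> point_lift HS le u v) -> u ≤ v).
  { intros u v Huv. rewrite <- (st_mul HS u).
    apply (proj1 (le_cone_imp HS (@bt (lower_sig c)) u v)).
    apply (ble_of_points HL). exact Huv. }
  apply (sle_antisym HS); apply I; intros le Hle; now apply K.
Qed.

Definition bowtie_glue (p : lower_sig c * lower_sig c) : S :=
  proj1_sig (fst p) · sneg (proj1_sig (snd p)).

Lemma cone_pair_glue (p : lower_sig c * lower_sig c) :
  in_bowtie p -> cone_pair (bowtie_glue p) = p.
Proof.
  destruct p as [a b]; intros [H1 H2]. unfold cone_pair, bowtie_glue; simpl.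
  pose proof (f_equal (@proj1_sig _ _) H1) as H3; simpl in H3.
  apply lower_ble in H2; simpl in H2.
  pose proof (smul_neg_cone HS (proj2_sig a) (proj2_sig b)) as H4.
  f_equal; apply sig_eq; simpl.
  - apply (sle_antisym HS).
    + set (z := smeet _ st).
      assert (Hz : z ≤ st) by apply (smeet_r HS).
      (* As [t = a \/ b], it suffices to bound [z /\ a] and [z /\ b = z · b <= a · ~b · b <= a]. *)
      rewrite <- (Hz : smeet z st = z), <- H3, (SM_distributive HS).
      apply (sjoin_le HS); [apply (smeet_r HS)|].
      rewrite <- (smul_neg_cone HS Hz (proj2_sig b)).
      apply (sle_trans HS) with (proj1_sig a · sneg (proj1_sig b) · proj1_sig b).
      * apply (smul_mono_l HS), (smeet_l HS).
      * rewrite <- (SM_mulA HS), (SM_mulC HS). apply (smul_neg_l HS).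
        apply (sle_trans HS) with (sneg st); [|apply (sneg_st_le HS)].
        rewrite (SM_mulC HS). apply (sneg_mul HS).
    + apply (sle_meet HS); [|apply (proj2_sig a)].
      (* From [a · b = a /\ b <= ~t] comes [a <= ~b], so [a = a · a <= a · ~b]. *)
      rewrite <- (SM_mul_idem HS (proj1_sig a)) at 1.
      apply (smul_mono HS); [apply (sle_refl HS)|].
      apply (proj2 (sle_neg HS _ _)). now rewrite H4.
  (* The negation of [a · ~b] is [a -> b]; splitting [t] as [a \/ b] again bounds its truncation by
     [b]. *)
  - rewrite <- (simpE HS). apply (sle_antisym HS).
    + set (z := smeet _ st).
      assert (Hz : z ≤ st) by apply (smeet_r HS).
      rewrite <- (Hz : smeet z st = z), <- H3, (SM_distributive HS).
      apply (sjoin_le HS); [|apply (smeet_r HS)].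
      rewrite <- (smul_neg_cone HS Hz (proj2_sig a)).
      apply (sres HS), (smeet_l HS).
    + apply (sle_meet HS); [|apply (proj2_sig b)].
      apply (sres HS). rewrite (SM_mulC HS). apply (smul_neg_l HS), (proj2_sig a).
Qed.

Lemma bowtie_glueK (x : S) : bowtie_glue (cone_pair x) = x.
Proof. apply cone_pair_inj, cone_pair_glue, cone_pair_bowtie. Qed.

Definition cone_split (d : upper_closed (lower_sig c)) (x : S) : upper_sig d :=
  exist _ (cone_pair x) (cone_pair_bowtie x).

Lemma cone_split_hom (d : upper_closed (lower_sig c)) : is_SM_hom (cone_split d).
Proof.
  assert (N : forall x, cone_split d (sneg x) = sneg (cone_split d x)).
  { intros x. apply sig_eq, cone_pair_neg. }
  assert (M : forall x y, cone_split d (x · y) = cone_split d x · cone_split d y).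
  { intros x y. apply sig_eq, cone_pair_mul. }
  split; trivial.
  - intros x y. apply sig_eq, cone_pair_meet.
  - intros x y. apply sig_eq, cone_pair_join.
  (* Both monoids define implication from product and negation. *)
  - intros x y. now rewrite (simpE (bowtie_SM HL d)), (simpE HS), N, M, N.
  - apply sig_eq; simpl. unfold cone_pair. f_equal; apply sig_eq; simpl.
    + apply (sle_refl HS).
    + apply (sneg_st_le HS).
Qed.

Lemma bowtie_glue_hom (d : upper_closed (lower_sig c)) :
  @is_SM_hom (upper_sig d) S (fun u => bowtie_glue (proj1_sig u)).
Proof.
  apply (@SM_hom_inverse S (upper_sig d) (cone_split d)).
  - apply bowtie_glueK.
  - intros [p Hp]. now apply sig_eq, cone_pair_glue.
  - apply cone_split_hom.
Qed.

End ConePair.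

(** * A bRS-algebra as the negative cone of its bowtie *)

Section Unit.

Variable A : bRS_sig.
Hypothesis HA : is_bRS A.
Variables (c : upper_closed A) (d : lower_closed (upper_sig c)).

Let HB := relative_Stone_Brouwerian (bRS_relative_Stone HA).

Lemma unit_bowtie (a : A) : in_bowtie (a, a ⇀ bf).
Proof.
  split; [apply (bRS_f HA)|].
  rewrite (meetC (Brouwerian_lattice HB)). apply (bimp_mp HB).
Qed.

Lemma bf_ble_join (a : A) : bf ⊑ a <-> a ⊔ bf = a.
Proof.
  split; intros H.
  - apply (ble_antisym HB); [|apply (ble_joinl HB)].
    apply (ble_join HB); [apply (ble_refl HB) | trivial].
  - rewrite <- H. apply (ble_joinr HB).
Qed.

Lemma neg_coneP (u : upper_sig c) :
  in_neg_cone u <-> bf ⊑ snd (proj1_sig u).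
Proof.
  unfold in_neg_cone, sle. destruct u as [[a b] Hab]; simpl.
  rewrite bf_ble_join. split; intros H.
  - apply (f_equal (@proj1_sig _ _)) in H; simpl in H. now injection H.
  - apply sig_eq; simpl. rewrite H. f_equal. apply (ble_top HB).
Qed.

(** From [a ⊓ b ⊑ bf] follows [b ⊑ a ⇀ bf]. Conversely, meet [a ⇀ bf] with [bt = a ⊔ b]: the part in
    [a] is below [bf], hence below [b]. *)
Lemma neg_cone_snd (u : upper_sig c) :
  in_neg_cone u -> snd (proj1_sig u) = fst (proj1_sig u) ⇀ bf.
Proof.
  rewrite neg_coneP. destruct u as [[a b] [H1 H2]]; simpl. intros H3.
  apply (ble_antisym HB).
  - apply (proj1 (Brouwerian_residuation HB _ _ _)).
    now rewrite (meetC (Brouwerian_lattice HB)).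
  - apply (ble_trans HB) with ((a ⇀ bf) ⊓ (a ⊔ b)).
    + rewrite H1. apply (ble_meet HB); [apply (ble_refl HB) | apply (ble_top HB)].
    + apply (ble_meet_join HB); [|apply (ble_meetr HB)].
      apply (ble_trans HB) with (1 := bimp_mp HB a bf), H3.
Qed.

Lemma neg_cone_eq (u v : lower_sig d) :
  fst (proj1_sig (proj1_sig u)) = fst (proj1_sig (proj1_sig v)) -> u = v.
Proof.
  destruct u as [u Hu], v as [v Hv]; simpl; intros H.
  apply sig_eq; simpl. apply sig_eq.
  pose proof (neg_cone_snd Hu) as Eu. pose proof (neg_cone_snd Hv) as Ev.
  destruct (proj1_sig u), (proj1_sig v); simpl in *. congruence.
Qed.

Lemma unit_neg_cone (a : A) :
  @in_neg_cone (upper_sig c) (exist _ (a, a ⇀ bf) (unit_bowtie a)).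
Proof. apply neg_coneP, (bimp_weak HB). Qed.

Definition bowtie_unit (a : A) : lower_sig d :=
  exist _ (exist _ (a, a ⇀ bf) (unit_bowtie a) : upper_sig c) (unit_neg_cone a).

Lemma bowtie_unit_hom : is_bRS_hom bowtie_unit.
Proof.
  split; intros; apply neg_cone_eq; simpl; try reflexivity.
  (* As [bf ⊑ a ⇀ bf], [delta] makes the second component top, so the conjunct comparing second
     components is top. *)
  rewrite (bimp_top HB (bimp_weak HB a bf)).
  rewrite (bimp_top HB (ble_top HB _)).
  now rewrite !(ble_top HB (a ⇀ b) : (a ⇀ b) ⊓ bt = a ⇀ b).
Qed.

Lemma bowtie_counit_hom :
  @is_bRS_hom (lower_sig d) A (fun u => fst (proj1_sig (proj1_sig u))).
Proof.
  apply (@bRS_hom_inverse A (lower_sig d) bowtie_unit).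
  - reflexivity.
  - intros u. now apply neg_cone_eq.
  - apply bowtie_unit_hom.
Qed.

End Unit.

(** * Functor laws and natural isomorphisms *)

Theorem mainTheorem3 :
  exists (up : upper_well_defined) (low : lower_well_defined),
    witness_equivalence (bowtie_upper up) (bowtie_lower low).
Proof.
  exists upper_wd, lower_wd. repeat apply conj.
  - split.
    + intros A. apply SM_hom_eq. extensionality u.
      apply sig_eq; simpl. now destruct (proj1_sig u).
    + intros A B C v u. apply SM_hom_eq. extensionality p.
      apply sig_eq; simpl. now destruct (proj1_sig p).
  - split.
    + intros S. apply bRS_hom_eq. extensionality u. now apply sig_eq.
    + intros S T U v u. apply bRS_hom_eq. extensionality p. now apply sig_eq.
  (* The unit is [bowtie_unit]; naturality is checked on first components, which determine elements
     of the cone. *)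
  - unshelve eexists; [|split].
    + intros A. exact (@BRSHom A (lower_ob lower_wd (upper_ob upper_wd A)) _
        (bowtie_unit_hom (bRS_axioms A) _)).
    + intros A B u. apply bRS_hom_eq. extensionality a.
      now apply (neg_cone_eq (bRS_axioms B)).
    + intros A.
      exists (@BRSHom (lower_ob lower_wd (upper_ob upper_wd A)) A _
        (bowtie_counit_hom (bRS_axioms A) _)).
      split; apply bRS_hom_eq; extensionality a; [reflexivity|].
      now apply (neg_cone_eq (bRS_axioms A)).
  (* The counit is [bowtie_glue], a term in product and negation and therefore natural. *)
  - unshelve eexists; [|split].
    + intros S. exact (@SMHom (upper_ob upper_wd (lower_ob lower_wd S)) S _
        (bowtie_glue_hom (SM_axioms S) _)).
    + intros S T u. apply SM_hom_eq. extensionality p.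
      destruct p as [[a b] Hp]. unfold bowtie_glue; simpl.
      now rewrite (SM_hom_mul (SM_funP u)), (SM_hom_neg (SM_funP u)).
    + intros S.
      exists (@SMHom S (upper_ob upper_wd (lower_ob lower_wd S)) _
        (cone_split_hom (SM_axioms S) _)).
      split; apply SM_hom_eq; extensionality x.
      * apply sig_eq, (cone_pair_glue (SM_axioms S)), (proj2_sig x).
      * apply (bowtie_glueK (SM_axioms S)).
Qed.
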